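(* Let $d\ge 2$ and let $\tau=(\tau_e)_{e\in\mathbb{E}^d}$ be i.i.d. non-negative random variables for which there exist $c_1,c_2,\alpha>0$ and $r\in(0,1]$ such that $\mathbb{P}(\tau_e=0)<p_c(d)$ and, for all sufficiently large $t>0$, $$c_1\exp(-\alpha t^r)\le \mathbb{P}(\tau_e>t)\le c_2\exp(-\alpha t^r).$$ Then for any $\xi>0$ and any $x\in\mathbb{R}^d\setminus\{0\}$, $$\lim_{n\to\infty}\frac{1}{n^r}\log \mathbb{P}\big(\mathrm{T}(0,nx)>n(\mu(x)+\xi)\big)=-2d\,\alpha\,\xi^r .$$
   Context: First-passage percolation on $\mathbb{Z}^d$: $\mathbb{E}^d$ is the set of (undirected) nearest-neighbour edges of $\mathbb{Z}^d$ and each edge $e$ carries the weight $\tau_e$. A path is a finite sequence $(x_i)_{i=1}^l$ in $\mathbb{Z}^d$ with $|x_i-x_{i+1}|_1=1$ for all $i$ (also regarded as a set of edges). The passage time of a path $\gamma$ is $\mathrm{T}(\gamma)=\sum_{e\in\gamma}\tau_e$. For $x\in\mathbb{R}^d$, $\lfloor x\rfloor=(\lfloor x_1\rfloor,\dots,\lfloor x_d\rfloor)$. For $x,y\in\mathbb{R}^d$, the first passage time is $\mathrm{T}(x,y)=\inf_\gamma \mathrm{T}(\gamma)$, the infimum over all finite paths $\gamma$ from $\lfloor x\rfloor$ to $\lfloor y\rfloor$. $p_c(d)$ is the critical probability of Bernoulli bond percolation on $\mathbb{Z}^d$. Since $\mathbb{E}\tau_e<\infty$, by Kingman's subadditive ergodic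 theorem for each $x\in\mathbb{R}^d$ there is a non-random constant $\mu(x)\ge 0$ (the time constant) with $\mu(x)=\lim_{t\to\infty}t^{-1}\mathrm{T}(0,tx)=\lim_{t\to\infty}t^{-1}\mathbb{E}[\mathrm{T}(0,tx)]$ almost surely. *)

(* Defs.v *)
From HB Require Import structures.
From mathcomp Require Import all_boot all_order all_algebra finmap.
From mathcomp Require Import all_classical all_reals all_analysis.
Set Implicit Arguments.
Unset Strict Implicit.
Unset Printing Implicit Defensive.
Import Order.TTheory GRing.Theory Num.Theory.
Import numFieldNormedType.Exports.
Local Open Scope classical_set_scope.
Local Open Scope ring_scope.

Section lattice.
Variable d : nat.

Definition vertex := 'rV[int]_d.

Definition adj : rel vertex :=
  fun x y => \sum_(i < d) `|x ord0 i - y ord0 i| == 1.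

(* Undirected edges are unordered pairs of adjacent vertices. *)
Definition is_edge (e : {fset vertex}) : bool :=
  `[< exists x y : vertex, adj x y /\ e = [fset x; y]%fset >].

Definition edge := {e : {fset vertex} | is_edge e}.

Definition is_path (x y : vertex) (g : seq vertex) : Prop :=
  exists p : seq vertex, [/\ g = x :: p, path adj x p & last x p = y].

(* As a set: an edge traversed several times occurs only once. *)
Definition path_edges (g : seq vertex) : set edge :=
  [set e | exists i : nat,
     (i.+1 < size g)%N /\ val e = [fset nth 0 g i; nth 0 g i.+1]%fset].

End lattice.

Section random_families.
Context {R : realType} {disp disp' : measure_display} {T : measurableType disp}
  {T' : measurableType disp'} (P : probability T R) {I : choiceType}.
Implicit Type X : I -> {RV P >-> T'}.

Definition mutually_independent X : Prop :=
  forall (J : {fset I}) (A : I -> set T'), (forall i, measurable (A i)) ->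
    P (\bigcap_(i in [set` J]) X i @^-1` A i) =
    (\prod_(i <- J) P (X i @^-1` A i))%E.

Definition identically_distributed X : Prop :=
  forall (i j : I) (A : set T'), measurable A ->
    distribution P (X i) A = distribution P (X j) A.

Definition iid X : Prop := mutually_independent X /\ identically_distributed X.

End random_families.

Section bernoulli_percolation.

Definition open_cluster (d : nat) (omega : edge d -> bool) (x : vertex d) :
    set (vertex d) :=
  [set y | exists2 g, is_path x y g & forall e, path_edges g e -> omega e].

Definition is_bernoulli_percolation (R : realType) (d : nat) (p : R)
    (disp : measure_display) (T : measurableType disp) (P : probability T R)
    (X : edge d -> {RV P >-> bool}) : Prop :=
  mutually_independent X /\ forall e, P [set w | X e w = true] = p%:E.

(* The law of the open edges depends only on p, so any realization of Bernoulli
   percolation determines the percolation probability. *)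
Definition is_percolation_probability (R : realType) (d : nat) (p : R)
    (theta : \bar R) : Prop :=
  exists (disp : measure_display) (T : measurableType disp)
    (P : probability T R) (X : edge d -> {RV P >-> bool}),
    is_bernoulli_percolation p X /\
    P [set w | infinite_set (open_cluster (fun e => X e w) 0)] = theta.

Definition critical_probability (R : realType) (d : nat) : R :=
  sup [set p : R | 0 <= p <= 1 /\ is_percolation_probability d p 0%E].

End bernoulli_percolation.

Section first_passage_percolation.
Context {R : realType} {d : nat} {disp : measure_display}
  {T : measurableType disp} (P : probability T R)
  (tau : edge d -> {RV P >-> R}).

Definition path_time (g : seq (vertex d)) (w : T) : R :=
  \sum_(e \in path_edges g) tau e w.

Definition floor_vertex (x : 'rV[R]_d) : vertex d := map_mx Num.floor x.

Definition passage_time (x y : 'rV[R]_d) (w : T) : R :=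
  inf [set path_time g w | g in is_path (floor_vertex x) (floor_vertex y)].

Definition time_constant (x : 'rV[R]_d) : R :=
  lim (t^-1 * fine 'E_P[passage_time 0 (t *: x)] @[t --> +oo]).

End first_passage_percolation.

(* Main.v *)
Require Import Defs.
From HB Require Import structures.
From mathcomp Require Import all_boot all_order all_algebra finmap.
From mathcomp Require Import all_classical all_reals all_analysis measurable_realfun.
From mathcomp Require Import zify ring lra.
Set Implicit Arguments.
Unset Strict Implicit.
Unset Printing Implicit Defensive.
Import Order.TTheory GRing.Theory Num.Theory.
Import numFieldNormedType.Exports.
Local Open Scope classical_set_scope.
Local Open Scope ring_scope.


(** The cheapest way to delay the passage from [0] to [n x] by [n xi] is to block
    an endpoint. Every path out of [0] uses one of the [2d] edges at [0]; if all
    of them weigh more than [n xi], the passage time grows by that amount, at the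
    price [P(tau > n xi) ^ (2d)], which is of order
    [exp (- 2d alpha xi^r n^r)]. Nothing is cheaper: far from the endpoints there
    are many disjoint detours, near an endpoint there are [2d] edge-disjoint
    routes, and [t |-> t^r] is subadditive for [r <= 1], so that sharing the delay
    between several edges, or between the two endpoints, does not lower the cost.

    Lower bound ([lower_bound]). Let [w'] be the configuration in which the edges
    at [0] get weight zero. The passage time of [w] is at least the smallest
    weight at [0] plus the passage time of [w'], and the two are independent. So
    only a positive lower bound for the probability that the passage time of [w']
    is at least [n (mu - e)] is wanted. It comes from the second moment
    ([paley_zygmund]): the mean is [n mu - O(1)] because mean passage times are
    subadditive up to a constant ([time_constant_exists]), and the second moment
    is [O(n^2)].

    Upper bound ([upper_bound]). Take [N] of order [delta n^r] disjoint parallel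
    tubes in the direction [x], translates of one another. A tube takes longer
    than [n (mu + e)] with a probability [p_n] that tends to zero
    ([tube_law_of_large_numbers], by the Chebyshev inequality and finite-range
    dependence). The tubes are independent, so that all of them are slow with
    probability [p_n ^ N], which is smaller than [exp (- A n^r)] for every [A].
    If one is fast, then the connections from [0] to its start and from its end
    to [n x] take together more than [n (xi - e)]. The [2d] edge-disjoint walks
    of [edge_disjoint_walks] turn this into
    [2d (n (xi - e))^r <= sum of the tau_e^r] over [O(N)] edges, and the
    exponential Markov inequality ([two_ends]) bounds the probability by
    [exp (- 2d beta (xi - e)^r n^r) M^O(N)] for any [beta < alpha], where [M] is
    the mean of [exp (beta tau^r)]. As [M^O(N) = exp (O(delta) n^r)], letting
    [delta] and [e] tend to zero and [beta] to [alpha] gives the rate.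

    All this takes place on the space of configurations with the product
    sigma-algebra. A law with independent, identically distributed coordinates is
    determined by its values on cylinders ([product_law_unique]); translation
    invariance and the independence of functions of disjoint sets of edges are
    two instances of this uniqueness. *)

(** * Product spaces and independence *)

Section product_space.
Context {R : realType} {I : choiceType}.

Definition cylinder (J : {fset I}) (A : I -> set R) : set (I -> R) :=
  \bigcap_(i in [set` J]) [set w | A i (w i)].

Definition cylinders : set (set (I -> R)) :=
  [set C | exists J A, (forall i, measurable (A i)) /\ C = cylinder J A].

Definition config := g_sigma_algebraType cylinders.

Lemma cylinder_set0 (A : I -> set R) : cylinder fset0 A = setT.
Proof. by apply/seteqP; split=> // w _ i /=; rewrite inE. Qed.

Lemma cylindersT : cylinders setT.
Proof.
by exists fset0, (fun=> setT); split=> //; rewrite cylinder_set0.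
Qed.

Lemma measurable_cylinder J A : (forall i, measurable (A i)) ->
  measurable (cylinder J A : set config).
Proof. by move=> mA; apply: sub_sigma_algebra; exists J, A. Qed.

Lemma cylinders_setI : setI_closed cylinders.
Proof.
move=> _ _ [J [A [mA ->]]] [K [B [mB ->]]].
exists (J `|` K)%fset,
  (fun i => (if i \in J then A i else setT) `&` (if i \in K then B i else setT)).
split.
  by move=> i; apply: measurableI; case: ifP.
apply/seteqP; split=> w.
  move=> [hJ hK] i _ /=; split; case: ifPn => // iJ; [exact: hJ|exact: hK].
move=> h; split=> i /= iJ.
  by have := h i; rewrite /= !inE iJ /= => /(_ isT) [].
by have := h i; rewrite /= !inE iJ orbT /= => /(_ isT) [].
Qed.

Lemma measurable_coord (i : I) : measurable_fun setT (fun w : config => w i).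
Proof.
move=> _ A mA; rewrite setTI; apply: sub_sigma_algebra.
exists [fset i]%fset, (fun=> A); split=> //.
apply/seteqP; split=> w /=; first by move=> h j /=; rewrite inE => /eqP ->.
by move/(_ i); apply; rewrite /= inE.
Qed.

Lemma measurable_config d (S : measurableType d) (f : S -> config) :
  (forall i, measurable_fun setT (fun s => f s i)) -> measurable_fun setT f.
Proof.
move=> mf; apply: (@measurability _ _ S config setT f cylinders) => //.
move=> _ [_ [J [A [mA ->]]] <-]; rewrite setTI.
rewrite [X in measurable X](_ : _ =
    \bigcap_(i in [set` J]) ((fun s => f s i) @^-1` A i)); last first.
  by apply/seteqP; split => s /= h i iJ; exact: h.
apply: fin_bigcap_measurable => [|i _]; first exact: finite_fset.
by rewrite -[X in measurable X]setTI; exact: mf.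
Qed.

(** [nu] is only a set function here, and [Q] too, so that the property makes
    sense for an image of a measure before the image is known to be a measure. *)
Definition has_product_law (nu : set R -> \bar R) (Q : set config -> \bar R) :=
  forall J A, (forall i, measurable (A i)) ->
    (Q (cylinder J A) = \prod_(i <- J) nu (A i))%E.

(** Cylinders form a pi-system that generates the sigma-algebra. *)
Lemma product_law_unique nu (Q : probability config R)
    (Q' : {measure set config -> \bar R}) :
  has_product_law nu Q -> has_product_law nu Q' ->
  forall A, measurable A -> Q A = Q' A.
Proof.
move=> hQ hQ' A mA.
apply: (@measure_unique _ R config cylinders (fun=> setT) _ _ _ _ Q Q') => //.
- exact: cylinders_setI.
- by move=> _; exact: cylindersT.
- by rewrite bigcup_const//; exists 0%N.
- move=> _ [J [B [mB ->]]]; exact: etrans (hQ _ _ mB) (esym (hQ' _ _ mB)).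
- by move=> _ /=; rewrite probability_setT ltry.
Qed.

Section transfer.
Context (nu : set R -> \bar R) (Q : probability config R).
Hypothesis lawQ : has_product_law nu Q.
Context d (S : measurableType d) (P : probability S R) (f : S -> config).
Hypothesis mf : measurable_fun setT f.
Hypothesis lawf : has_product_law nu (fun A => P (f @^-1` A)).

Let f_mfun : {mfun S >-> config} := HB.pack f (isMeasurableFun.Build _ _ _ _ _ mf).

(** Any random configuration [f] with the right cylinder probabilities can be used
    to compute expectations under [Q]. *)
Lemma product_law_integral (h : config -> \bar R) : measurable_fun setT h ->
  (forall w, 0 <= h w)%E -> (\int[Q]_w h w = \int[P]_s h (f s))%E.
Proof.
move=> mh h0.
rewrite -(@ge0_integral_distribution _ _ _ _ _ P f_mfun _ mh h0).
by apply: eq_measure_integral => A mA _; apply: (@product_law_unique nu).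
Qed.

Lemma product_law_measure (A : set config) : measurable A ->
  Q A = P (f @^-1` A).
Proof. by move=> mA; apply: (@product_law_unique nu Q (distribution P f_mfun)). Qed.

End transfer.

(** A pointwise form of measurability with respect to the coordinates in [F]; it
    avoids sub-sigma-algebras altogether. *)
Definition depends_on {U} (F : set I) (f : config -> U) :=
  forall w w' : config, (forall i, F i -> w i = w' i) -> f w = f w'.

Section independence.
Context (nu : probability R R) (Q : probability config R).
Hypothesis lawQ : has_product_law nu Q.

Lemma product_law_reindex (s s' : I -> I) : cancel s s' -> cancel s' s ->
  has_product_law nu (fun A : set config => Q ((fun w : config => (w \o s : config)) @^-1` A)).
Proof.
move=> ss' s's J A mA /=.
rewrite [X in Q X](_ : _ = cylinder (s @` J)%fset (A \o s')); last first.
  apply/seteqP; split=> w /= h i /=.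
    by move=> /imfsetP[j /= jJ ->]; rewrite ss'; exact: h.
  move=> iJ; have := h (s i); rewrite /= ss'; apply; exact: in_imfset.
rewrite lawQ => [|i]; last exact: mA.
rewrite big_imfset /=; last by move=> i j _ _; exact: (can_inj ss').
by under eq_bigr do rewrite ss'.
Qed.

(** Two independent configurations glued along [F]: the outcome has law [Q]
    again, and a function of the coordinates in [F] sees only the first one. *)
Definition resample (F : set I) (p : config * config) : config :=
  fun i => if `[< F i >] then p.1 i else p.2 i.

Lemma measurable_resample F : measurable_fun setT (resample F).
Proof.
apply: measurable_config => i; rewrite /resample.
by case: `[< F i >]; apply: (measurableT_comp (measurable_coord i)).
Qed.

Lemma product_law_resample F :
  has_product_law nu (fun A => (Q \x Q)%E (resample F @^-1` A)).
Proof.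
move=> J A mA /=.
pose A1 i := if `[< F i >] then A i else setT.
pose A2 i := if `[< F i >] then setT else A i.
have mA1 i : measurable (A1 i) by rewrite /A1; case: ifP.
have mA2 i : measurable (A2 i) by rewrite /A2; case: ifP.
rewrite [X in (Q \x Q)%E X](_ : _ = cylinder J A1 `*` cylinder J A2); last first.
  apply/seteqP; split=> -[w w'] /= => [h|[h1 h2] i iJ /=].
    by split=> i iJ; have := h i iJ; rewrite /= /resample /A1 /A2; case: ifP.
  have := h1 i iJ; have := h2 i iJ; rewrite /= /resample /A1 /A2.
  by case: ifP.
rewrite product_measure1E; [|exact: measurable_cylinder..].
transitivity ((\prod_(i <- J) nu (A1 i)) * \prod_(i <- J) nu (A2 i))%E.
  by congr (_ * _)%E; exact: lawQ.
rewrite -big_split /=; apply: eq_bigr => i _; rewrite /A1 /A2.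
by case: ifP => _; rewrite probability_setT ?mule1 ?mul1e.
Qed.

(** Evaluated at [resample F (w, w')], the product [f * g] becomes
    [f w * g w'], and the Fubini-Tonelli theorem separates the factors. *)
Lemma expectation_mul (F : set I) (f g : config -> \bar R) :
  measurable_fun setT f -> measurable_fun setT g ->
  (forall w, 0 <= f w)%E -> (forall w, 0 <= g w)%E ->
  depends_on F f -> depends_on (~` F) g ->
  (\int[Q]_w (f w * g w) = (\int[Q]_w f w) * (\int[Q]_w g w))%E.
Proof.
move=> mf mg f0 g0 Ff Fg.
rewrite (product_law_integral lawQ (measurable_resample F) (product_law_resample F));
  [|exact: emeasurable_funM|by move=> w; exact: mule_ge0].
rewrite (eq_integral (fun p : config * config => f p.1 * g p.2)%E); last first.
  move=> [w w'] _ /=; congr (_ * _)%E.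
    by apply: Ff => i Fi; rewrite /resample; case: ifPn => // /asboolPn.
  by apply: Fg => i Fi; rewrite /resample; case: ifPn => // /asboolP.
rewrite fubini_tonelli1; last by move=> p; exact: mule_ge0.
  rewrite /fubini_F /=.
  rewrite (eq_integral (fun w => f w * \int[Q]_w' g w')%E); last first.
    by move=> w _; rewrite ge0_integralZl.
  by rewrite ge0_integralZr//; exact: integral_ge0.
by apply: emeasurable_funM; [apply: (measurableT_comp mf)|apply: (measurableT_comp mg)].
Qed.

End independence.

End product_space.

(** * Means of nonnegative functions *)

Section nonnegative_means.
Context {d} {T : measurableType d} {R : realType} (P : probability T R).
Implicit Types (f g : T -> R) (A : set T).

Definition mean f : R := fine (\int[P]_t (f t)%:E)%E.

(** Nonnegative integrable functions: for them expectations can be handled as real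
    numbers, without integrability side conditions on differences. *)
Definition has_mean f : Prop :=
  [/\ measurable_fun setT f, forall t, 0 <= f t &
      (\int[P]_t (f t)%:E < +oo)%E].

Lemma mean_fin f : has_mean f -> (\int[P]_t (f t)%:E)%E = (mean f)%:E.
Proof.
move=> [mf f0 fi]; rewrite fineK// ge0_fin_numE//.
by apply: integral_ge0 => t _; rewrite lee_fin.
Qed.

Lemma mean_ge0 f : (forall t, 0 <= f t) -> 0 <= mean f.
Proof. by move=> f0; apply/fine_ge0/integral_ge0 => t _; rewrite lee_fin. Qed.

Lemma has_mean_le f g : measurable_fun setT f -> (forall t, 0 <= f t <= g t) ->
  has_mean g -> has_mean f.
Proof.
move=> mf fg [mg g0 gi]; split=> //; first by move=> t; have /andP[] := fg t.
apply: le_lt_trans gi; apply: ge0_le_integral => //.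
- by move=> t _; rewrite lee_fin; have /andP[] := fg t.
- exact/measurable_EFinP.
- exact/measurable_EFinP.
- by move=> t _; rewrite lee_fin; have /andP[] := fg t.
Qed.

Lemma mean_le f g : has_mean f -> has_mean g -> (forall t, f t <= g t) ->
  mean f <= mean g.
Proof.
move=> hf hg fg; rewrite -lee_fin -!mean_fin//.
have [mf f0 _] := hf; have [mg _ _] := hg; apply: ge0_le_integral => //.
- by move=> t _; rewrite lee_fin.
- exact/measurable_EFinP.
- exact/measurable_EFinP.
- by move=> t _; rewrite lee_fin.
Qed.

Let intD f g : has_mean f -> has_mean g ->
  (\int[P]_t (f t + g t)%:E = (mean f + mean g)%:E)%E.
Proof.
move=> hf hg; have [mf f0 _] := hf; have [mg g0 _] := hg.
rewrite EFinD -!mean_fin//; under eq_integral do rewrite EFinD.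
apply: ge0_integralD => //; try (by move=> t _; rewrite lee_fin).
- exact/measurable_EFinP.
- exact/measurable_EFinP.
Qed.

Lemma has_meanD f g : has_mean f -> has_mean g -> has_mean (fun t => f t + g t).
Proof.
move=> hf hg; have [mf f0 _] := hf; have [mg g0 _] := hg; split.
- exact: measurable_funD.
- by move=> t; exact: addr_ge0.
- by rewrite intD ?ltry.
Qed.

Lemma meanD f g : has_mean f -> has_mean g ->
  mean (fun t => f t + g t) = mean f + mean g.
Proof. by move=> hf hg; rewrite {1}/mean intD. Qed.

Let intZ k f : 0 <= k -> has_mean f ->
  (\int[P]_t (k * f t)%:E = (k * mean f)%:E)%E.
Proof.
move=> k0 hf; have [mf f0 _] := hf.
rewrite EFinM -mean_fin//; under eq_integral do rewrite EFinM.
apply: ge0_integralZl => //; first exact/measurable_EFinP.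
by move=> t _; rewrite lee_fin.
Qed.

Lemma has_meanZ k f : 0 <= k -> has_mean f -> has_mean (fun t => k * f t).
Proof.
move=> k0 hf; have [mf f0 _] := hf; split.
- by apply: measurable_funM => //; exact: measurable_cst.
- by move=> t; exact: mulr_ge0.
- by rewrite intZ ?ltry.
Qed.

Lemma meanZ k f : 0 <= k -> has_mean f -> mean (fun t => k * f t) = k * mean f.
Proof. by move=> k0 hf; rewrite {1}/mean intZ. Qed.

Let int_cst k : (\int[P]_t k%:E = k%:E)%E.
Proof.
have -> := integral_cst P measurableT k%:E.
by rewrite [X in (_ * X)%E](probability_setT P) mule1.
Qed.

Lemma has_mean_cst k : 0 <= k -> has_mean (fun=> k).
Proof. by move=> k0; split=> //; rewrite int_cst ltry. Qed.

Lemma mean_cst k : mean (fun=> k) = k.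
Proof. by rewrite /mean int_cst. Qed.

Lemma has_mean_sum (I : Type) (s : seq I) (f : I -> T -> R) :
  (forall i, has_mean (f i)) -> has_mean (fun t => \sum_(i <- s) f i t).
Proof.
move=> hf; elim: s => [|i s IH].
  by under eq_fun do rewrite big_nil; exact: has_mean_cst.
by under eq_fun do rewrite big_cons; exact: has_meanD.
Qed.

Lemma mean_sum (I : Type) (s : seq I) (f : I -> T -> R) :
  (forall i, has_mean (f i)) ->
  mean (fun t => \sum_(i <- s) f i t) = \sum_(i <- s) mean (f i).
Proof.
move=> hf; elim: s => [|i s IH].
  by under eq_fun do rewrite big_nil; rewrite mean_cst big_nil.
under eq_fun do rewrite big_cons.
by rewrite meanD ?IH ?big_cons//; exact: has_mean_sum.
Qed.

Lemma has_mean_indic A : measurable A -> has_mean \1_A.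
Proof.
move=> mA; split; first exact: measurable_indic.
  by move=> t; rewrite indicE ler0n.
by rewrite integral_indic// setIT (le_lt_trans (probability_le1 P mA))// ltry.
Qed.

Lemma mean_indic A : measurable A -> mean \1_A = fine (P A).
Proof. by move=> mA; rewrite /mean integral_indic// setIT. Qed.

Lemma prob_fin A : measurable A -> P A = (fine (P A))%:E.
Proof. by move=> mA; rewrite fineK// fin_num_measure. Qed.

Lemma measurable_ge f c : measurable_fun setT f -> measurable [set t | c <= f t].
Proof.
move=> mf; rewrite (_ : [set t | _] = setT `&` f @^-1` `[c, +oo[).
  by apply: mf => //; exact: measurable_itv.
by rewrite setTI; apply/seteqP; split=> t; rewrite /= in_itv /= andbT.
Qed.

Lemma measurable_gt f c : measurable_fun setT f -> measurable [set t | c < f t].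
Proof.
move=> mf; rewrite (_ : [set t | _] = setT `&` f @^-1` `]c, +oo[).
  by apply: mf => //; exact: measurable_itv.
by rewrite setTI; apply/seteqP; split=> t; rewrite /= in_itv /= andbT.
Qed.

Lemma markov_ineq f c : has_mean f -> 0 <= c -> fine (P [set t | c <= f t]) * c <= mean f.
Proof.
move=> hf c0; have [mf f0 _] := hf; have mA := measurable_ge c mf.
rewrite -mean_indic// mulrC -meanZ//; last exact: has_mean_indic.
apply: mean_le => //; first by apply: has_meanZ => //; exact: has_mean_indic.
move=> t; rewrite indicE; case: (boolP (t \in _)) => [|_]; last by rewrite mulr0.
by rewrite inE /= mulr1.
Qed.

Lemma prob_le A B : measurable A -> measurable B -> A `<=` B -> fine (P A) <= fine (P B).
Proof.
by move=> mA mB AB; rewrite -lee_fin -!prob_fin//; apply: le_measure; rewrite ?inE.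
Qed.

Lemma prob_leU A B C : measurable A -> measurable B -> measurable C ->
  A `<=` B `|` C -> fine (P A) <= fine (P B) + fine (P C).
Proof.
move=> mA mB mC AB; rewrite -lee_fin EFinD -!prob_fin//.
rewrite (le_trans _ (measureU2 P mB mC))//.
by apply: le_measure; rewrite ?inE//; exact: measurableU.
Qed.

Lemma mean_decreasing_cvg (f : nat -> T -> R) g : has_mean (f 0%N) ->
  (forall n, measurable_fun setT (f n)) -> (forall n t, 0 <= f n t <= f 0%N t) ->
  (forall t, f n t @[n --> \oo] --> g t) ->
  mean (f n) @[n --> \oo] --> mean g.
Proof.
move=> hf mf f0 fg.
have mg : measurable_fun setT g by apply: measurable_fun_cvg mf _ => t _; exact: fg.
have g0 t : 0 <= g t.
  by apply: cvgr_to_ge (fg t) _; near=> n; have /andP[] := f0 n t.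
have hg : has_mean g.
  apply: (has_mean_le mg _ hf) => t; rewrite g0 /=.
  by apply: cvgr_to_le (fg t) _; near=> n; have /andP[] := f0 n t.
have hfn n : has_mean (f n) by exact: has_mean_le (mf n) (f0 n) hf.
have [m0 _ i0] := hf.
have := @dominated_convergence _ _ _ P setT measurableT (fun n t => (f n t)%:E)
  (fun t => (g t)%:E) (fun t => (f 0%N t)%:E).
case=> [n|||||_ _ h].
- exact/measurable_EFinP/mf.
- exact/measurable_EFinP.
- by apply: aeW => t _; apply: cvg_EFin; [near=> n|exact: fg].
- apply/integrableP; split; first exact/measurable_EFinP.
  rewrite (eq_integral (fun t => (f 0%N t)%:E))// => t _.
  by rewrite abse_EFin ger0_norm//; have /andP[] := f0 0%N t.
- by apply: aeW => t n _; rewrite abse_EFin lee_fin; have /andP[f1 f2] := f0 n t; rewrite ger0_norm.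
by rewrite mean_fin// in h; exact: fine_cvg h.
Unshelve. all: by end_near.
Qed.

End nonnegative_means.

Section independent_means.
Context {R : realType} {I : choiceType}.
Context (nu : probability R R) (Q : probability (@config R I) R).
Hypothesis lawQ : has_product_law nu Q.
Implicit Types f g : @config R I -> R.

Lemma depends_on_sub {U} (F F' : set I) (f : @config R I -> U) :
  F `<=` F' -> depends_on F f -> depends_on F' f.
Proof. by move=> FF' hf w w' ww'; apply: hf => i /FF'; exact: ww'. Qed.

Let coord_mfun (i : I) : {mfun (@config R I) >-> R} :=
  HB.pack (fun w : @config R I => w i)
    (isMeasurableFun.Build _ _ _ _ _ (measurable_coord i)).

Let integral_coord (g : R -> R) i : has_mean nu g ->
  (\int[Q]_w (g (w i))%:E = \int[nu]_x (g x)%:E)%E.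
Proof.
move=> [mg g0 _].
have <- := @ge0_integral_distribution _ _ _ _ _ Q (coord_mfun i) (EFin \o g).
- apply: eq_measure_integral => A mA _.
  transitivity (Q (cylinder [fset i]%fset (fun=> A))); last by rewrite lawQ// big_seq_fset1.
  congr (Q _); apply/seteqP; split=> w /=; first by move=> h j /=; rewrite inE => /eqP ->.
  by move/(_ i); apply; rewrite /= inE.
- exact/measurable_EFinP.
- by move=> x; rewrite lee_fin.
Qed.

Lemma has_mean_coord (g : R -> R) i : has_mean nu g -> has_mean Q (fun w => g (w i)).
Proof.
move=> hg; have [mg g0 gi] := hg; split=> //; last by rewrite integral_coord.
exact: (measurableT_comp mg (measurable_coord i)).
Qed.

Lemma mean_coord (g : R -> R) i : has_mean nu g -> mean Q (fun w => g (w i)) = mean nu g.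
Proof. by move=> hg; rewrite /mean integral_coord. Qed.

Lemma mean_mul_indep (F : set I) f g : has_mean Q f -> has_mean Q g ->
  depends_on F f -> depends_on (~` F) g ->
  has_mean Q (fun w => f w * g w) /\
  mean Q (fun w => f w * g w) = mean Q f * mean Q g.
Proof.
move=> hf hg Ff Fg; have [mf f0 _] := hf; have [mg g0 _] := hg.
have E : (\int[Q]_w (f w * g w)%:E = (mean Q f * mean Q g)%:E)%E.
  rewrite EFinM -!mean_fin//; under eq_integral do rewrite EFinM.
  apply: (expectation_mul lawQ (F := F)).
  - exact/measurable_EFinP.
  - exact/measurable_EFinP.
  - by move=> w; rewrite lee_fin.
  - by move=> w; rewrite lee_fin.
  - by move=> w w' ww'; rewrite (Ff _ _ ww').
  - by move=> w w' ww'; rewrite (Fg _ _ ww').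
split; last by rewrite {1}/mean E.
split; [exact: measurable_funM|by move=> w; exact: mulr_ge0|by rewrite E ltry].
Qed.

(** By induction on [s]: the product over the tail depends on coordinates outside
    [F j]. *)
Lemma mean_prod_indep (J : eqType) (s : seq J) (F : J -> set I)
    (f : J -> @config R I -> R) : uniq s ->
  (forall j, has_mean Q (f j)) -> (forall j, depends_on (F j) (f j)) ->
  (forall i j x, i \in s -> j \in s -> F i x -> F j x -> i = j) ->
  has_mean Q (fun w => \prod_(j <- s) f j w) /\
  mean Q (fun w => \prod_(j <- s) f j w) = \prod_(j <- s) mean Q (f j).
Proof.
move=> us hf Ff; elim: s us => [_ _|j s IH /= /andP[js us] dF].
  have -> : (fun w : @config R I => \prod_(j <- [::]) f j w) = (fun=> 1).
    by apply/funext => w; rewrite big_nil.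
  rewrite big_nil mean_cst.
  by split=> //; exact: has_mean_cst.
have [|hs ms] := IH us; first by move=> i i' x ii ii'; apply: dF; rewrite inE ?ii ?ii' orbT.
have -> : (fun w : @config R I => \prod_(i <- j :: s) f i w) =
    (fun w => f j w * \prod_(i <- s) f i w).
  by apply/funext => w; rewrite big_cons.
rewrite big_cons -ms.
apply: (mean_mul_indep (F := F j)) => // w w' ww'.
apply: eq_big_seq => i is_; apply: Ff => x Fi; apply: ww' => Fj.
by move: js; rewrite (dF j i x) ?is_ ?inE ?eqxx ?is_ ?orbT.
Qed.

(** The indicator of the intersection is the product of the indicators. *)
Lemma prob_bigcap_indep (J : eqType) (s : seq J) (F : J -> set I)
    (A : J -> set (@config R I)) : uniq s ->
  (forall j, measurable (A j)) -> (forall j, depends_on (F j) (A j)) ->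
  (forall i j x, i \in s -> j \in s -> F i x -> F j x -> i = j) ->
  measurable [set w | forall j, j \in s -> A j w] /\
  fine (Q [set w | forall j, j \in s -> A j w]) = \prod_(j <- s) fine (Q (A j)).
Proof.
move=> us mA FA dF.
have mC : measurable [set w | forall j, j \in s -> A j w].
  elim: s {us dF} => [|i s IH].
    by rewrite (_ : [set w | _] = setT)//; apply/seteqP; split.
  rewrite (_ : [set w | _] = A i `&` [set w | forall j, j \in s -> A j w]).
    exact: measurableI.
  apply/seteqP; split=> w /= => [h|[h1 h2] j].
    by split=> [|j js]; apply: h; rewrite inE ?eqxx ?js ?orbT.
  by rewrite inE => /orP[/eqP ->|/h2].
have hA j : has_mean Q (\1_(A j) : @config R I -> R) by exact: has_mean_indic.
have dA j : depends_on (F j) (\1_(A j) : @config R I -> R).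
  move=> w w' ww'; rewrite !indicE; congr (nat_of_bool _)%:R.
  by apply/idP/idP; rewrite !inE (FA j _ _ ww').
split=> //; have [_ mp] := mean_prod_indep us hA dA dF.
under eq_bigr do rewrite -mean_indic//.
rewrite -mp -mean_indic//; congr mean; apply/funext => w.
rewrite indicE; case: (boolP (w \in _)) => [|/negP].
  rewrite inE => h; rewrite big_seq big1 => [//|j js].
  by rewrite indicE mem_set//; exact: h.
move=> h; apply/esym/eqP; rewrite prodf_seq_eq0; apply/hasP.
apply: contrapT => hn; apply: h; rewrite inE => j js.
apply: contrapT => hA'; apply: hn; exists j => //=.
by rewrite indicE memNset.
Qed.

Lemma mean_reindex (s s' : I -> I) f : cancel s s' -> cancel s' s ->
  has_mean Q f -> mean Q (fun w => f (w \o s)) = mean Q f.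
Proof.
move=> ss' s's [mf f0 _]; congr fine; symmetry.
apply: (product_law_integral lawQ (f := fun w : config => (w \o s : config))
  _ (product_law_reindex lawQ ss' s's)).
- by apply: measurable_config => i; exact: measurable_coord.
- exact/measurable_EFinP.
- by move=> w; rewrite lee_fin.
Qed.

Lemma prob_reindex (s s' : I -> I) (A : set (@config R I)) :
  cancel s s' -> cancel s' s -> measurable A ->
  Q [set w : @config R I | A (w \o s)] = Q A.
Proof.
move=> ss' s's mA; symmetry.
apply: (product_law_measure lawQ (f := fun w : config => (w \o s : config))
  _ (product_law_reindex lawQ ss' s's)) => //.
by apply: measurable_config => i; exact: measurable_coord.
Qed.

End independent_means.

(** * Second moment inequalities *)

Section local_dependence.
Context {d} {T : measurableType d} {R : realType} (P : probability T R).

Lemma sum_window_le (k a b : nat) : (\sum_(j < k) (a <= j < b) <= b - a)%N.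
Proof.
suff : (\sum_(j < k) (a <= j < b) <= minn k b - a)%N by lia.
elim: k => [|k IH]; first by rewrite big_ord0.
rewrite big_ord_recr /=; move: IH; case: (boolP (a <= k < b)%N) => /=; lia.
Qed.

(** Each [i] has at most [2 q] indices [j] at distance less than [q]. For those the
    mean of the product is at most [B] by [2 x y <= x^2 + y^2]; for all others it
    factorizes. *)
Lemma mean_square_local (k q : nat) (Y : nat -> T -> R) (B : R) : 0 <= B ->
  (forall j, has_mean P (Y j)) -> (forall j, has_mean P (fun t => Y j t ^+ 2)) ->
  (forall j, mean P (fun t => Y j t ^+ 2) <= B) ->
  (forall i j, (i + q <= j)%N ->
    mean P (fun t => Y i t * Y j t) = mean P (Y i) * mean P (Y j)) ->
  has_mean P (fun t => (\sum_(j < k) Y j t) ^+ 2) /\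
  mean P (fun t => (\sum_(j < k) Y j t) ^+ 2) <=
    (\sum_(j < k) mean P (Y j)) ^+ 2 + (2 * k * q)%:R * B.
Proof.
move=> B0 h1 h2 hB hI.
have hm i j : has_mean P (fun t => Y i t * Y j t) /\ mean P (fun t => Y i t * Y j t) <= B.
  have [mi i0 _] := h1 i; have [mj j0 _] := h1 j.
  have hs : has_mean P (fun t => 2^-1 * (Y i t ^+ 2 + Y j t ^+ 2)).
    by apply: has_meanZ; [rewrite invr_ge0|exact: has_meanD].
  have hle t : 0 <= Y i t * Y j t <= 2^-1 * (Y i t ^+ 2 + Y j t ^+ 2).
    by rewrite mulr_ge0//=; have := sqr_ge0 (Y i t - Y j t); nra.
  have hp : has_mean P (fun t => Y i t * Y j t).
    by apply: has_mean_le hle hs; exact: measurable_funM.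
  split=> //; apply: (le_trans (mean_le hp hs _)).
    by move=> t; have /andP[] := hle t.
  rewrite meanZ ?meanD ?invr_ge0//; last exact: has_meanD.
  by have := hB i; have := hB j; lra.
have hij i j : mean P (fun t => Y i t * Y j t) <= mean P (Y i) * mean P (Y j) +
    ((i.+1 - q <= j < i + q)%N)%:R * B.
  have m0 l : 0 <= mean P (Y l) by apply: mean_ge0; have [] := h1 l.
  case: (boolP (i.+1 - q <= j < i + q)%N) => hw.
    by rewrite mul1r (le_trans (hm i j).2)// lerDr mulr_ge0.
  rewrite mul0r addr0.
  have [ij|ij] := leqP (i + q) j; first by rewrite hI.
  have ji : (j + q <= i)%N by lia.
  by rewrite [leRHS]mulrC -hI//; under eq_fun do rewrite mulrC.
have E : (fun t => (\sum_(j < k) Y j t) ^+ 2) =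
    (fun t => \sum_(i < k) \sum_(j < k) Y i t * Y j t).
  by apply/funext => t; rewrite expr2 big_distrlr.
rewrite E; split.
  by apply: has_mean_sum => i; apply: has_mean_sum => j; exact: (hm i j).1.
rewrite mean_sum => [|i]; last by apply: has_mean_sum => j; exact: (hm i j).1.
rewrite (eq_bigr (fun i : 'I_k => \sum_(j < k) mean P (fun t => Y i t * Y j t))); last first.
  by move=> i _; rewrite mean_sum// => j; exact: (hm i j).1.
apply: (@le_trans _ _ (\sum_(i < k) \sum_(j < k) (mean P (Y i) * mean P (Y j) +
    ((i.+1 - q <= j < i + q)%N)%:R * B))).
  by apply: ler_sum => i _; apply: ler_sum => j _; exact: hij.
under eq_bigr do rewrite big_split /=.
rewrite big_split /= -big_distrlr /= -expr2 lerD2l.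
under eq_bigr do rewrite -mulr_suml.
rewrite -mulr_suml ler_wpM2r//.
under eq_bigr do rewrite -natr_sum.
rewrite -natr_sum ler_nat; apply: (@leq_trans (\sum_(i < k) (2 * q))).
  by apply: leq_sum => i _; apply: (leq_trans (sum_window_le _ _ _)); lia.
by rewrite sum_nat_const card_ord; lia.
Qed.

(** The variance of the sum is of order [k q B], against the square of [k e]. *)
Lemma chebyshev_local (k q : nat) (Y : nat -> T -> R) (B e : R) :
  0 <= B -> 0 < e -> (0 < k)%N ->
  (forall j, has_mean P (Y j)) -> (forall j, has_mean P (fun t => Y j t ^+ 2)) ->
  (forall j, mean P (fun t => Y j t ^+ 2) <= B) ->
  (forall i j, (i + q <= j)%N ->
    mean P (fun t => Y i t * Y j t) = mean P (Y i) * mean P (Y j)) ->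
  fine (P [set t | \sum_(j < k) mean P (Y j) + k%:R * e < \sum_(j < k) Y j t]) <=
    2 * q%:R * B / (e ^+ 2 * k%:R).
Proof.
move=> B0 e0 k0 h1 h2 hB hI.
have [hS2 mS2] := mean_square_local k B0 h1 h2 hB hI.
have hS : has_mean P (fun t => \sum_(j < k) Y j t) by exact: has_mean_sum.
set S := fun t => _ in hS; have [mS S0 _] := hS.
set s := \sum_(j < k) mean P (Y j) in mS2 *.
have sE : mean P S = s by rewrite mean_sum.
have s0 : 0 <= s by rewrite -sE; exact: mean_ge0.
have hss : has_mean P (fun t => (S t) ^+ 2 + s ^+ 2).
  by apply: has_meanD => //; apply: has_mean_cst; exact: sqr_ge0.
have hD : has_mean P (fun t => (S t - s) ^+ 2).
  apply: has_mean_le _ _ hss.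
    by apply: measurable_funX; apply: measurable_funB => //; exact: measurable_cst.
  by move=> t; rewrite sqr_ge0 /=; have := S0 t; nra.
have mD : mean P (fun t => (S t - s) ^+ 2) <= (2 * k * q)%:R * B.
  have h : mean P (fun t => (S t - s) ^+ 2) + 2 * s * mean P S =
      mean P (fun t => S t ^+ 2) + s ^+ 2.
    rewrite -[in RHS](mean_cst P (s ^+ 2)) -meanD//; last by apply: has_mean_cst; exact: sqr_ge0.
    rewrite -meanZ ?mulr_ge0// -meanD//; last by apply: has_meanZ => //; rewrite mulr_ge0.
    by congr mean; apply/funext => t; rewrite sqrrB mulr2n; ring.
  by move: mS2 h; rewrite -/S sE; lra.
have ke0 : 0 < k%:R * e by rewrite mulr_gt0// ltr0n.
have := markov_ineq hD (sqr_ge0 (k%:R * e)).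
have mle : fine (P [set t | s + k%:R * e < S t]) <=
    fine (P [set t | (k%:R * e) ^+ 2 <= (S t - s) ^+ 2]).
  apply: prob_le.
  - exact: measurable_gt.
  - by apply: measurable_ge; have [] := hD.
  - by move=> t /= h; rewrite lerXn2r ?nnegrE//; lra.
move=> hm; rewrite (le_trans mle)//.
have k0' : (0 : R) < k%:R by rewrite ltr0n.
rewrite ler_pdivlMr ?mulr_gt0// ?exprn_gt0//.
rewrite -(ler_pM2r k0'); apply: le_trans (_ : (2 * k * q)%:R * B <= _); last by rewrite !natrM; nra.
by apply: le_trans mD; apply: le_trans hm; rewrite exprMn expr2; nra.
Qed.

End local_dependence.

(** A linearized form of the Paley-Zygmund inequality: on [a <= Z] one has
    [Z <= l Z^2 + 1 / (4 l)], and elsewhere [Z <= a]. The parameter [l] is left to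
    the caller, which replaces the Cauchy-Schwarz inequality by an optimization. *)
Lemma paley_zygmund {d} {T : measurableType d} {R : realType} (P : probability T R)
    (Z : T -> R) (a l : R) :
  has_mean P Z -> has_mean P (fun t => Z t ^+ 2) -> 0 <= a -> 0 < l ->
  mean P Z <= a + l * mean P (fun t => Z t ^+ 2) +
    fine (P [set t | a <= Z t]) / (4 * l).
Proof.
move=> hZ hZ2 a0 l0; have [mZ Z0 _] := hZ.
have mA := measurable_ge a mZ.
have l4 : 0 <= (4 * l)^-1 by rewrite invr_ge0 mulr_ge0// ltW.
have h1 : has_mean P (fun t => l * Z t ^+ 2) by apply: has_meanZ => //; exact: ltW.
have h2 : has_mean P (fun t => (4 * l)^-1 * \1_[set t | a <= Z t] t).
  by apply: has_meanZ => //; exact: has_mean_indic.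
have h3 : has_mean P (fun t => a + l * Z t ^+ 2 + (4 * l)^-1 * \1_[set t | a <= Z t] t).
  apply: has_meanD => //; apply: has_meanD => //; exact: has_mean_cst.
apply: (le_trans (mean_le hZ h3 _)).
  move=> t; rewrite indicE; case: (boolP (t \in _)) => [_|/negP].
    rewrite mulr1; have : 0 <= (l * Z t - 2^-1) ^+ 2 / l by rewrite divr_ge0 ?sqr_ge0// ltW.
    have -> : (l * Z t - 2^-1) ^+ 2 / l = l * Z t ^+ 2 - Z t + (4 * l)^-1.
      by field; rewrite gt_eqF.
    lra.
  rewrite inE /= => /negP; rewrite -ltNge mulr0 addr0 => Za.
  by have := sqr_ge0 (Z t); nra.
rewrite meanD//; last by apply: has_meanD => //; exact: has_mean_cst.
rewrite meanD ?mean_cst//; last exact: has_mean_cst.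
rewrite (meanZ (ltW l0))// meanZ//; last exact: has_mean_indic.
by rewrite mean_indic// lerD2l mulrC.
Qed.

(** * Moments of Weibull tails *)

Section weibull.
Context {R : realType}.

(** If [k < Z <= k + 1] then [exp (be Z) <= exp (be (k + 1))], so that the
    exponential moment is dominated by a geometric series of ratio
    [exp (- (al - be))]. *)
Lemma exp_moment {d} {T : measurableType d} (P : probability T R) (Z : T -> R)
    (C al be : R) : measurable_fun setT Z -> (forall t, 0 <= Z t) -> 0 < be -> be < al ->
  (forall k : nat, fine (P [set t | k%:R < Z t]) <= C * expR (- al * k%:R)) ->
  has_mean P (fun t => expR (be * Z t)).
Proof.
move=> mZ Z0 be0 beal tail.
have mE : measurable_fun setT (fun t => expR (be * Z t)).
  apply: (measurableT_comp (@measurable_expR R)).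
  by apply: measurable_funM => //; exact: measurable_cst.
split=> [//|t|]; first exact: expR_ge0.
pose A k := [set t | k%:R < Z t].
have mA k : measurable (A k) by exact: measurable_gt.
pose f k t : \bar R := (expR (be * k.+1%:R) * \1_(A k) t)%:E.
have f0 k t : (0 <= f k t)%E by rewrite lee_fin mulr_ge0 ?expR_ge0.
have mf k : measurable_fun setT (f k).
  apply/measurable_EFinP; apply: measurable_funM; first exact: measurable_cst.
  exact: measurable_indic.
have bound t : ((expR (be * Z t))%:E <= (expR be)%:E + \sum_(k <oo) f k t)%E.
  have S0 : (0 <= \sum_(k <oo) f k t)%E by exact: nneseries_ge0.
  have [Z1|Z1] := leP (Z t) 1.
    by apply: le_trans (leeDl _ S0); rewrite lee_fin ler_expR -[leRHS]mulr1 ler_pM2l.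
  pose k := Num.truncn (Z t).
  have /andP[k1 k2] := Num.Theory.truncn_itv (Z0 t).
  have [j [j1 j2]] : exists j : nat, j%:R < Z t <= j.+1%:R /\ True.
    have [kZ|kZ] := eqVneq (k%:R) (Z t); last first.
      by exists k; split=> //; rewrite lt_neqAle kZ k1 ltW.
    exists k.-1; split=> //; have k0 : (0 < k)%N by rewrite -(ltr_nat R) kZ (lt_trans _ Z1).
    by rewrite prednK// -kZ lexx andbT ltr_nat prednK.
  have /andP[jZ Zj] := j1.
  apply: (@le_trans _ _ (f j t)).
    by rewrite /f indicE mem_set//= mulr1 lee_fin ler_expR ler_pM2l.
  rewrite -[leLHS]add0e; apply: leeD; first by rewrite lee_fin expR_ge0.
  rewrite (@nneseriesD1 _ _ j)//= leeDl//; exact: nneseries_ge0.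
pose z := expR (- (al - be)).
have z0 : 0 < z by exact: expR_gt0.
have z1 : z < 1 by rewrite -expR0 ltr_expR; lra.
have C0 : 0 <= C.
  have := tail 0%N; rewrite mulr0 expR0 mulr1; apply: le_trans; exact: fine_ge0.
have intf k : (\int[P]_t f k t <= (C * expR be * z ^+ k)%:E)%E.
  have := mean_fin (has_meanZ (expR_ge0 (be * k.+1%:R)) (has_mean_indic P (mA k))).
  rewrite /f => ->; rewrite meanZ ?expR_ge0//; last exact: has_mean_indic.
  rewrite mean_indic// lee_fin.
  apply: le_trans (_ : expR (be * k.+1%:R) * (C * expR (- al * k%:R)) <= _).
    by rewrite ler_wpM2l ?expR_ge0 ?tail.
  rewrite mulrCA -expRD -mulrA ler_wpM2l// /z -expRM_natr -expRD ler_expR -natr1.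
  by rewrite le_eqVlt; apply/orP; left; apply/eqP; ring.
have sumf : (\sum_(k <oo) \int[P]_t f k t <= (C * expR be * (1 - z)^-1)%:E)%E.
  apply: lime_le.
    by apply: is_cvg_nneseries => k _ _; exact: integral_ge0.
  near=> n; apply: (le_trans (lee_sum _ (fun k _ => intf k))).
  rewrite sumEFin lee_fin -mulr_sumr ler_wpM2l ?mulr_ge0 ?expR_ge0//.
  rewrite -[(1 - z)^-1]mul1r ler_pdivlMr ?subr_gt0//.
  have -> : (\sum_(0 <= k < n) z ^+ k) * (1 - z) = 1 - z ^+ n.
    elim: (n) => [|l IH]; first by rewrite big_geq// expr0 mul0r subrr.
    by rewrite big_nat_recr//= mulrDl IH exprS; ring.
  by rewrite gerBl exprn_ge0// ltW.
have mS : measurable_fun setT (fun t => \sum_(k <oo) f k t)%E.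
  exact: ge0_emeasurable_sum.
have h : (\int[P]_t (expR (be * Z t))%:E <=
    \int[P]_t ((expR be)%:E + \sum_(k <oo) f k t))%E.
  apply: ge0_le_integral => [//|t _|||t _].
  - by rewrite lee_fin expR_ge0.
  - exact/measurable_EFinP.
  - by apply: emeasurable_funD => //; exact: measurable_cst.
  - exact: bound.
apply: (le_lt_trans h).
rewrite ge0_integralD//; last by move=> t _; exact: nneseries_ge0.
rewrite integral_nneseries//.
rewrite (_ : \int[P]_x (expR be)%:E = (expR be)%:E)%E; last first.
  have := mean_fin (has_mean_cst P (expR_ge0 be)).
  by rewrite mean_cst.
by apply: le_lt_trans (leeD (lexx _) sumf) _; rewrite -EFinD ltry.
Unshelve. all: by end_near.
Qed.

Variable (nu : probability R R) (r : R).
Hypothesis r0 : 0 < r.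

(** The tail bound of [x^r] at integers is the Weibull tail at [k^(1/r)]. Up
    to [t0] the constant [C] makes the bound exceed one. *)
Lemma weibull_exp_moment (c t0 al be : R) : 0 < be -> be < al ->
  nu `]-oo, 0[%classic = 0%E ->
  (forall t, t0 < t -> fine (nu `]t, +oo[%classic) <= c * expR (- al * t `^ r)) ->
  has_mean nu (fun x => expR (be * `|x| `^ r)).
Proof.
move=> be0 beal nu0 tail.
pose t1 := Num.max t0 0; pose C := Num.max c (expR (al * t1 `^ r)).
have mZ : measurable_fun setT (fun x : R => `|x| `^ r).
  exact: (measurableT_comp (measurable_powR _) (@normr_measurable R setT)).
have al0 : 0 < al by exact: lt_trans beal.
apply: (@exp_moment _ _ nu _ C al) => //.
move=> k; pose s : R := k%:R `^ r^-1.
have sr : s `^ r = k%:R by rewrite -powRrM mulVf ?powRr1// gt_eqF.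
have mA : measurable [set x : R | k%:R < `|x| `^ r] by exact: measurable_gt.
have h1 : fine (nu [set x : R | k%:R < `|x| `^ r]) <= fine (nu `]s, +oo[%classic).
  have sub : [set x : R | k%:R < `|x| `^ r] `<=` `]-oo, 0[%classic `|` `]s, +oo[%classic.
    move=> x /= kx; rewrite !in_itv /= andbT.
    have [x0|x0] := ltP x 0; [by left|right].
    rewrite ltNge; apply/negP => xs.
    have : x `^ r <= s `^ r by apply: ge0_ler_powR; rewrite ?nnegrE ?powR_ge0 ?(ltW r0).
    by rewrite sr leNgt -{1}(ger0_norm x0) kx.
  have := prob_leU nu mA (measurable_itv `]-oo, 0[) (measurable_itv `]s, +oo[) sub.
  by rewrite nu0 /= add0r.
apply: (le_trans h1).
have [st|st] := ltP t0 s.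
  apply: (le_trans (tail _ st)); rewrite sr ler_wpM2r ?expR_ge0//.
  by rewrite /C le_max lexx.
apply: (@le_trans _ _ 1).
  by rewrite -lee_fin fineK ?fin_num_measure// probability_le1.
apply: le_trans (_ : expR (al * t1 `^ r) * expR (- al * k%:R) <= _); last first.
  by rewrite ler_wpM2r ?expR_ge0// /C le_max lexx orbT.
rewrite -expRD -[leLHS]expR0 ler_expR mulNr subr_ge0 ler_pM2l// -sr.
have st1 : s <= t1 by rewrite /t1 le_max st.
by apply: ge0_ler_powR; rewrite ?nnegrE ?powR_ge0 ?(ltW r0)// (le_trans _ st1)// powR_ge0.
Qed.

(** With [y = |x|^r] and an integer [j >= 2 / r], one has [x^2 <= y^j] for
    [y >= 1], and a power of [y] is dominated by an exponential. *)
Lemma second_moment (be : R) : 0 < be ->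
  has_mean nu (fun x => expR (be * `|x| `^ r)) -> has_mean nu (fun x => x ^+ 2).
Proof.
move=> be0 hE.
pose j := (Num.truncn (2 / r)).+1.
have jr : 2 / r <= j%:R.
  have h : 0 <= 2 / r by rewrite divr_ge0// ltW.
  by have /andP[_ /ltW] := Num.Theory.truncn_itv h.
have j0 : (0 : R) < j%:R by rewrite ltr0n.
pose K := 1 + (j%:R / be) ^+ j.
have K0 : 0 <= (j%:R / be) ^+ j by rewrite exprn_ge0// divr_ge0 ?ltW.
apply: (@has_mean_le _ _ _ nu _ (fun x => K * expR (be * `|x| `^ r))).
- exact: measurable_funX.
- move=> x; rewrite sqr_ge0 -real_normK ?num_real//=.
  set y := `|x| `^ r; have y0 : 0 <= y by exact: powR_ge0.
  have x0 : 0 <= `|x| by [].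
  have e1 : 1 <= expR (be * y) by rewrite -expR0 ler_expR mulr_ge0// ltW.
  have [x1|x1] := leP `|x| 1.
    apply: (@le_trans _ _ 1); first by rewrite expr_le1.
    by rewrite (le_trans e1)// ler_peMl ?expR_ge0// lerDl.
  have -> : `|x| ^+ 2 = y `^ (2 / r).
    by rewrite /y -powRrM mulrC divfK ?gt_eqF// powR_mulrn.
  have y1 : 1 <= y by rewrite -(powRr0 `|x|) ler_powR// ltW.
  apply: (le_trans (ler_powR y1 jr)); rewrite powR_mulrn//.
  have h : be * y / j%:R <= expR (be * y / j%:R).
    by have := expR_ge1Dx (be * y / j%:R); lra.
  have b0 : 0 <= be * y / j%:R by rewrite divr_ge0// mulr_ge0// ltW.
  have h2 : (be * y / j%:R) ^+ j <= expR (be * y).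
    have -> : be * y = be * y / j%:R * j%:R by rewrite divfK// gt_eqF.
    rewrite expRM_natr divfK ?gt_eqF//.
    by rewrite lerXn2r ?nnegrE ?expR_ge0.
  have -> : y ^+ j = (j%:R / be) ^+ j * (be * y / j%:R) ^+ j.
    by rewrite -exprMn; congr (_ ^+ _); field; rewrite !gt_eqF.
  apply: ler_pM => //; rewrite ?exprn_ge0//; first by rewrite /K lerDr.
- by apply: has_meanZ => //; rewrite addr_ge0.
Qed.

End weibull.

(** * Walks and passage times inside a region *)

Section lattice_paths.
Context {R : realType} {d : nat}.
Local Notation vertex := (vertex d).
Local Notation edge := (edge d).
Local Notation weights := (@config R edge).
Implicit Types (u v x y z : vertex) (p : seq vertex) (w : weights) (V : set vertex).

(** Consecutive vertices that are not adjacent contribute nothing; on a walk,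
    every step contributes its edge. *)
Definition edges x p : seq edge := pmap insub (pairmap (fun u v => [fset u; v]%fset) x p).

Definition walk V x y p :=
  [/\ path (@adj d) x p, last x p = y & forall v, v \in x :: p -> V v].

(** Repeated edges count once, as the passage time of a path is a sum over its set
    of edges. The absolute value makes the functional nonnegative on the whole
    space of configurations. *)
Definition weight w (s : seq edge) : R := \sum_(e <- undup s) `|w e|.

(** First passage time from [x] to [y] by walks that stay inside [V]; zero when
    there is no such walk. Restricting the walks makes the time a function of the
    edges inside [V], hence the independence of disjoint regions. *)
Definition fpt V x y w : R := inf [set weight w (edges x p) | p in walk V x y].

Lemma weight_ge0 w s : 0 <= weight w s.
Proof. exact: sumr_ge0. Qed.

Lemma weight_le_sum w s : weight w s <= \sum_(e <- s) `|w e|.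
Proof.
rewrite /weight; elim: s => //= e s IH; case: ifP => _; rewrite !big_cons ?lerD2l//.
by rewrite (le_trans IH)// lerDr.
Qed.

Lemma weight_subset w (s t : seq edge) : {subset s <= t} -> weight w s <= weight w t.
Proof.
move=> st; rewrite /weight.
have : uniq (undup s) := undup_uniq s.
have : uniq (undup t) := undup_uniq t.
have : {subset undup s <= undup t} by move=> e; rewrite !mem_undup; exact: st.
move: (undup s) (undup t) => {st}{}s {}t; elim: s t => [|e s IH] t st ut us.
  by rewrite big_nil; exact: sumr_ge0.
have et : e \in t by apply: st; rewrite inE eqxx.
move: us => /= /andP[es us]; rewrite big_cons (perm_big _ (perm_to_rem et)) big_cons.
rewrite lerD2l; apply: IH => //; last exact: rem_uniq.
move=> f fs; rewrite mem_rem_uniq// inE st ?inE ?fs ?orbT// andbT.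
by apply: contraNneq es => <-.
Qed.

Lemma weight_cat w (s t : seq edge) : weight w (s ++ t) <= weight w s + weight w t.
Proof.
rewrite /weight -big_cat /=; apply: le_trans (weight_le_sum _ _).
by apply: weight_subset => e; rewrite !mem_cat !mem_undup.
Qed.

Lemma edges_cat x p q : edges x (p ++ q) = edges x p ++ edges (last x p) q.
Proof. by rewrite /edges pairmap_cat pmap_cat. Qed.

Lemma size_edges x p : (size (edges x p) <= size p)%N.
Proof. by rewrite size_pmap (leq_trans (count_size _ _))// size_pairmap. Qed.

Lemma mem_edges x p e : (e \in edges x p) =
  (val e \in pairmap (fun u v => [fset u; v]%fset) x p).
Proof. by rewrite /edges mem_pmap_sub. Qed.

Lemma mem_edges_vertices x p e v :
  e \in edges x p -> v \in val e -> v \in x :: p.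
Proof.
rewrite mem_edges; elim: p x => //= y p IH x; rewrite !inE => /orP[/eqP ->|].
  by rewrite !inE => /orP[] ->; rewrite ?orbT.
by move=> h vs; have := IH _ h vs; rewrite inE => ->; rewrite orbT.
Qed.

Lemma path_edgesE x p : path_edges (x :: p) = [set` edges x p].
Proof.
have E i : (i < size p)%N -> nth fset0 (pairmap (fun u v => [fset u; v]%fset) x p) i =
    [fset nth 0 (x :: p) i; nth 0 (x :: p) i.+1]%fset.
  by move=> ip; rewrite (nth_pairmap 0).
apply/seteqP; split=> e /=; rewrite mem_edges.
  move=> [i [/= ip ve]]; apply/(nthP fset0).
  exists i; [by rewrite size_pairmap|rewrite E; [exact/esym/ve|exact: ip]].
move/(nthP fset0) => [i]; rewrite size_pairmap => ip; rewrite E // => ve.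
by exists i; split => //; exact/esym.
Qed.

Lemma walk_cat V x y z p q : walk V x y p -> walk V y z q -> walk V x z (p ++ q).
Proof.
move=> [p1 p2 p3] [q1 q2 q3]; split; first by rewrite cat_path p1 p2.
  by rewrite last_cat p2.
move=> v; rewrite -cat_cons mem_cat => /orP[/p3//|vq].
by apply: q3; rewrite inE vq orbT.
Qed.

Lemma walk_sub V V' x y p : V `<=` V' -> walk V x y p -> walk V' x y p.
Proof. by move=> VV' [p1 p2 p3]; split=> // v /p3 /VV'. Qed.

Lemma adjC x y : adj x y = adj y x.
Proof. by rewrite /adj; under eq_bigr do rewrite distrC. Qed.

(** Only the inclusion of the edge sets is needed to compare weights. *)
Lemma walk_rev V x y p : walk V x y p ->
  exists2 q, walk V y x q & {subset edges y q <= edges x p}.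
Proof.
elim: p x => [|z p IH] x [/= p1 p2 p3].
  by move: p2 => <-; exists [::]; [split=> //|move=> e].
move/andP: p1 => [xz p1]; have [|q wq sq] := IH z.
  by split=> // v vp; apply: p3; rewrite inE vp orbT.
have [q1 q2 q3] := wq; exists (q ++ [:: x]).
  apply: (walk_cat wq); split=> //=; first by rewrite adjC xz.
  by move=> v; rewrite !inE => /orP[]/eqP ->; apply: p3; rewrite !inE eqxx ?orbT.
move=> e; rewrite edges_cat mem_cat => /orP[/sq|]; rewrite !mem_edges/= !inE.
  by move=> ->; rewrite orbT.
by rewrite q2 fsetUC => ->.
Qed.

Lemma fpt_has_lbound V x y w :
  has_lbound [set weight w (edges x p) | p in walk V x y].
Proof. by exists 0 => _ [p _ <-]; exact: weight_ge0. Qed.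

Lemma fpt_le V x y w p : walk V x y p -> fpt V x y w <= weight w (edges x p).
Proof. by move=> wp; apply: ge_inf; [exact: fpt_has_lbound|exists p]. Qed.

Lemma fpt_ge V x y w a : walk V x y !=set0 ->
  (forall p, walk V x y p -> a <= weight w (edges x p)) -> a <= fpt V x y w.
Proof.
move=> [p wp] h; apply: lb_le_inf; first by exists (weight w (edges x p)), p.
by move=> _ [q wq <-]; exact: h.
Qed.

Lemma fpt_lt V x y w a : walk V x y !=set0 -> fpt V x y w < a ->
  exists2 p, walk V x y p & weight w (edges x p) < a.
Proof.
move=> [p wp] h; apply: contrapT => hn.
suff : a <= fpt V x y w by rewrite leNgt h.
apply: fpt_ge; first by exists p.
by move=> q wq; rewrite leNgt; apply/negP => hq; apply: hn; exists q.
Qed.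

Lemma fpt_no_walk V x y : ~ (walk V x y !=set0) -> fpt V x y = cst 0.
Proof.
move=> ne; apply/funext => w; rewrite /fpt (_ : walk V x y = set0) ?image_set0 ?inf0//.
by rewrite -subset0 => p wp; apply: ne; exists p.
Qed.

Lemma fpt_ge0 V x y w : 0 <= fpt V x y w.
Proof.
have [ne|/fpt_no_walk ->//] := pselect (walk V x y !=set0).
by apply: fpt_ge => // p _; exact: weight_ge0.
Qed.

Lemma fpt_mono V V' x y w : V `<=` V' -> walk V x y !=set0 ->
  fpt V' x y w <= fpt V x y w.
Proof.
move=> VV' ne; apply: fpt_ge => // p wp; apply: fpt_le; exact: walk_sub wp.
Qed.

Lemma fpt_triangle V x y z w : walk V x y !=set0 -> walk V y z !=set0 ->
  fpt V x z w <= fpt V x y w + fpt V y z w.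
Proof.
move=> ne1 ne2; apply/ler_addgt0Pr => e e0.
have [p wp lp] : exists2 p, walk V x y p & weight w (edges x p) < fpt V x y w + e / 2.
  by apply: fpt_lt => //; rewrite ltrDl divr_gt0.
have [q wq lq] : exists2 q, walk V y z q & weight w (edges y q) < fpt V y z w + e / 2.
  by apply: fpt_lt => //; rewrite ltrDl divr_gt0.
have := fpt_le w (walk_cat wp wq); rewrite edges_cat.
have [_ -> _] := wp => /le_trans; apply.
rewrite (le_trans (weight_cat _ _ _))// (le_trans (lerD (ltW lp) (ltW lq)))//.
by rewrite addrACA -splitr.
Qed.

Lemma fptC V x y w : fpt V x y w = fpt V y x w.
Proof.
suff h a b : walk V a b !=set0 -> fpt V b a w <= fpt V a b w.
  have [ne|ne] := pselect (walk V x y !=set0).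
    apply/eqP; rewrite eq_le !h//.
    by have [p /walk_rev[q wq _]] := ne; exists q.
  rewrite (fpt_no_walk ne) fpt_no_walk// => -[p /walk_rev[q wq _]].
  by apply: ne; exists q.
move=> ne; apply: fpt_ge => // p /walk_rev[q wq sq].
exact: le_trans (fpt_le _ wq) (weight_subset _ sq).
Qed.

Definition inside V : set edge := [set e : edge | forall v, v \in val e -> V v].

Lemma depends_on_fpt V x y : depends_on (inside V) (fpt V x y : weights -> R).
Proof.
move=> w w' ww'; congr inf; apply: eq_imagel => p [_ _ pV].
apply: eq_big_seq => e; rewrite mem_undup => ep; rewrite ww'// => v ve.
by apply: pV; exact: mem_edges_vertices ep ve.
Qed.

Lemma measurable_weight s : measurable_fun setT (fun w : weights => weight w s).
Proof.
apply: measurable_sum => e; apply: measurableT_comp => //; exact: measurable_coord.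
Qed.

(** There are countably many walks. *)
Lemma measurable_fpt V x y : measurable_fun setT (fpt V x y : weights -> R).
Proof.
have [[p0 wp0]|ne] := pselect (walk V x y !=set0); last first.
  rewrite fpt_no_walk//; exact: measurable_cst.
move=> mT; apply: (measurability _ (RGenInftyO.measurableE R)) => //.
move=> _ [_ [a ->] <-]; rewrite setTI; pose pathT : countType := seq vertex.
pose below (o : option pathT) : set weights :=
  [set w | if o is Some p then walk V x y p /\ weight w (edges x p) < a else False].
have below_meas o : measurable (below o).
  case: o => [p|]; last by rewrite (_ : below None = set0)// -subset0.
  have [wp|nwp] := pselect (walk V x y p); last first.
    by rewrite (_ : below _ = set0)// -subset0 => w [].
  rewrite (_ : below _ = (fun w : weights => weight w (edges x p)) @^-1` `]-oo, a[).
    by rewrite -[X in measurable X]setTI; apply: measurable_weight => //; exact: measurable_itv.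
  by apply/seteqP; split=> w; rewrite /= in_itv/= ; [case|split].
rewrite [X in measurable X](_ : _ = \bigcup_n below (@choice.unpickle pathT n)).
  by apply: bigcupT_measurable => n; exact: below_meas.
apply/seteqP; split=> w.
  move=> wa; have {wa}: fpt V x y w < a by move: wa; rewrite /= in_itv.
  move=> /(fpt_lt (ex_intro _ p0 wp0))[p wp h].
  by exists (@choice.pickle pathT p) => //; rewrite choice.pickleK.
move=> [n _]; case: choice.unpickle => // p [wp h].
by rewrite /= in_itv /= (le_lt_trans (fpt_le _ wp)).
Qed.

End lattice_paths.

(** * Geometry of the lattice *)

Section lattice_geometry.
Context {R : realType} {d : nat}.
Local Notation vertex := (vertex d).
Local Notation edge := (edge d).
Local Notation weights := (@config R edge).
Implicit Types (u v x y z : vertex) (p : seq vertex) (w : weights) (V : set vertex).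

Definition l1norm v : nat := (\sum_(i < d) `|v ord0 i|)%N.

Lemma l1normZ v : (l1norm v)%:Z = \sum_(i < d) `|v ord0 i|.
Proof. by rewrite /l1norm (big_morph Posz PoszD (erefl _)). Qed.

Lemma adjE x y : adj x y = (l1norm (x - y) == 1%N).
Proof.
rewrite /adj -eqz_nat l1normZ; congr (_ == _).
by apply: eq_bigr => i _; rewrite !mxE.
Qed.

Lemma l1normD u v : (l1norm (u + v)%R <= l1norm u + l1norm v)%N.
Proof.
rewrite -lez_nat PoszD !l1normZ -big_split /=; apply: ler_sum => i _.
by rewrite mxE ler_normD.
Qed.

Lemma l1normN v : l1norm (- v) = l1norm v.
Proof. by rewrite /l1norm; apply: eq_bigr => i _; rewrite mxE abszN. Qed.

Lemma l1norm_0 : l1norm 0 = 0%N.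
Proof. by rewrite /l1norm big1// => i _; rewrite mxE. Qed.

Lemma l1norm_eq0 v : l1norm v = 0%N -> v = 0.
Proof.
move=> /eqP; rewrite /l1norm sum_nat_eq0 => /forallP v0; apply/rowP => i.
by rewrite mxE; apply/eqP; rewrite -absz_eq0; exact: v0.
Qed.

Lemma l1norm_coord v i : (`|v ord0 i| <= l1norm v)%N.
Proof. by rewrite /l1norm (bigD1 i)//= leq_addr. Qed.

Lemma l1norm_delta i : l1norm (delta_mx 0 i) = 1%N.
Proof.
rewrite /l1norm (bigD1 i)//= big1 => [|j ji]; first by rewrite mxE !eqxx.
by rewrite mxE (negbTE ji) andbF.
Qed.

(** Walking monotonically in each coordinate, one never leaves the ball. *)
Lemma walk_l1ball0 u : exists p,
  walk [set v | (l1norm v <= l1norm u)%N] 0 u p /\ (size p <= l1norm u)%N.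
Proof.
move: {-1}(l1norm u) (erefl (l1norm u)) => m; elim: m u => [|m IH] u um.
  exists [::]; split=> //; rewrite (l1norm_eq0 um); split=> // v.
  by rewrite inE => /eqP -> /=; rewrite l1norm_0.
have [i ui] : exists i, u ord0 i != 0.
  apply/existsP; rewrite -negb_forall; apply: contra_eqN um => /forallP h.
  by rewrite /l1norm big1// => i _; rewrite (eqP (h i)).
pose s : vertex := sgz (u ord0 i) *: delta_mx 0 i.
have s1 : l1norm s = 1%N.
  rewrite /l1norm (bigD1 i)//= big1 => [|j ji]; first by rewrite !mxE !eqxx mulr1; case: sgzP ui.
  by rewrite !mxE (negbTE ji) andbF mulr0.
have us : l1norm (u - s) = m.
  apply: succn_inj; rewrite -um /l1norm (bigD1 i)//= [RHS](bigD1 i)//= -addSn; congr (_ + _)%N.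
    by rewrite !mxE !eqxx mulr1; move: (u ord0 i) ui => k; case: sgzP; lia.
  by apply: eq_bigr => j ji; rewrite !mxE (negbTE ji) andbF mulr0 subr0.
have [p [[p1 p2 p3] sp]] := IH _ us.
exists (rcons p u); split; last by rewrite size_rcons.
split; last 2 first.
- by rewrite last_rcons.
- move=> v; rewrite -rcons_cons mem_rcons inE => /orP[/eqP ->/=|/p3/= vm].
    by rewrite um.
  by rewrite (leq_trans vm).
- by rewrite rcons_path p1 p2 adjE -l1normN !opprB addrCA subrr addr0 s1.
Qed.

Lemma is_edge_shift z (e : {fset vertex}) :
  is_edge e -> is_edge ((fun v : vertex => v + z)%R @` e)%fset.
Proof.
move=> /asboolP[x [y [xy ->]]]; apply/asboolP; exists (x + z), (y + z).
split; last by rewrite imfsetU !imfset_fset1.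
by rewrite adjE opprD addrACA subrr addr0 -adjE.
Qed.

Definition eshift z (e : edge) : edge := Sub _ (is_edge_shift z (valP e)).

Lemma val_eshift z e : val (eshift z e) = ((fun v : vertex => v + z)%R @` val e)%fset.
Proof. exact: SubK. Qed.

Lemma mem_eshift z e v : (v \in val (eshift z e)) = (v - z \in val e).
Proof.
rewrite val_eshift; apply/imfsetP/idP => [[u /= ue ->]|ve]; first by rewrite addrK.
by exists (v - z); rewrite ?subrK.
Qed.

Lemma eshiftK z : cancel (eshift z) (eshift (- z)).
Proof.
by move=> e; apply/val_inj/fsetP => v; rewrite !mem_eshift opprK addrK.
Qed.

Lemma eshiftNK z : cancel (eshift (- z)) (eshift z).
Proof. by move=> e; rewrite -[X in eshift X]opprK eshiftK. Qed.

Lemma edges_shift z x p :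
  edges (x + z) [seq v + z | v <- p] = [seq eshift z e | e <- edges x p].
Proof.
rewrite /edges; elim: p x => //= y p IH x; rewrite IH.
rewrite (_ : [fset (x + z)%R; (y + z)%R] =
    (fun v : vertex => v + z)%R @` [fset x; y])%fset; last first.
  by rewrite imfsetU !imfset_fset1.
case: insubP => /= [e _ ve|]; case: insubP => /= [f _ vf|] //.
- congr (_ :: _); apply: val_inj; rewrite val_eshift.
  have -> : val f = [fset x; y]%fset by exact: vf.
  exact: ve.
- move=> /negP h; exfalso; apply: h.
  rewrite (_ : [fset x; y] = (fun v : vertex => v - z)%R @` val e)%fset.
    exact/is_edge_shift/valP.
  have -> : val e = ((fun v : vertex => v + z)%R @` [fset x; y])%fset by exact: ve.
  by rewrite !imfsetU !imfset_fset1 !addrK.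
- move=> /negP h; exfalso; apply: h.
  have <- : val f = [fset x; y]%fset by exact: vf.
  exact/is_edge_shift/valP.
Qed.

Lemma weight_shift z w (s : seq edge) :
  weight w [seq eshift z e | e <- s] = weight (w \o eshift z) s.
Proof. by rewrite /weight undup_map_inj ?big_map//; exact: can_inj (eshiftK z). Qed.

Lemma walk_shift z V x y p : walk V x y p ->
  walk [set v | V (v - z)] (x + z) (y + z) [seq v + z | v <- p].
Proof.
move=> [p1 p2 p3]; split.
- rewrite -[x + z]/((fun v => v + z) x) path_map; apply: sub_path p1 => u v; rewrite /= !adjE.
  by rewrite opprD addrACA subrr addr0.
- by rewrite -[x + z]/((fun v => v + z) x) last_map p2.
- by move=> v; rewrite -(map_cons (fun v => v + z)) => /mapP[u /p3 Vu ->] /=; rewrite addrK.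
Qed.

(** Translating the region and the endpoints amounts to translating the weights. *)
Lemma fpt_shift z V x y w :
  fpt [set v | V (v - z)] (x + z) (y + z) w = fpt V x y (w \o eshift z).
Proof.
congr inf; apply/seteqP; split=> _ [p wp <-].
  exists [seq v - z | v <- p].
    have := walk_shift (- z) wp; rewrite !addrK; apply: walk_sub => v /=.
    by rewrite opprK addrK.
  rewrite -weight_shift -edges_shift -map_comp (eq_map (g := id)) ?map_id//.
  by move=> v /=; rewrite subrK.
exists [seq v + z | v <- p]; first exact: walk_shift.
by rewrite edges_shift weight_shift.
Qed.

Definition l1ball z (K : nat) : set vertex := [set v | (l1norm (v - z)%R <= K)%N].

Lemma walk_l1ball x y : exists2 p, walk (l1ball x (l1norm (y - x)%R)) x y p &
  (size p <= l1norm (y - x)%R)%N.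
Proof.
have [p [wp sp]] := walk_l1ball0 (y - x).
exists [seq v + x | v <- p]; last by rewrite size_map.
by have := walk_shift x wp; rewrite add0r subrK.
Qed.

Lemma walkT x y : walk setT x y !=set0.
Proof. by have [p wp _] := walk_l1ball x y; exists p; apply: walk_sub wp. Qed.

Lemma l1ball_sub z K K' : (K <= K')%N -> l1ball z K `<=` l1ball z K'.
Proof. by move=> KK' v /leq_trans; apply. Qed.

End lattice_geometry.

Section passage_time.
Context {R : realType} {d : nat} {disp : measure_display}
  {T : measurableType disp} (P : probability T R) (tau : edge d -> {RV P >-> R}).
Hypothesis tau_ge0 : forall e t, 0 <= tau e t.

Lemma passage_timeE (x y : 'rV[R]_d) t : passage_time tau x y t =
  fpt setT (floor_vertex x) (floor_vertex y) (fun e => tau e t).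
Proof.
rewrite /passage_time /fpt; congr inf; apply/seteqP.
have E u p : path_time tau (u :: p) t = weight (fun e => tau e t) (edges u p).
  rewrite /path_time /weight path_edgesE (_ : [set` edges u p] = [set` undup (edges u p)]).
    rewrite -fsbig_seq ?undup_uniq//; apply: eq_bigr => e _.
    by rewrite ger0_norm.
  by apply/seteqP; split=> e /=; rewrite mem_undup.
split=> a [].
  by move=> g [p [-> p1 p2]] <-; exists p; [split|rewrite E].
by move=> p [p1 p2 _] <-; exists (floor_vertex x :: p); [exists p|rewrite E].
Qed.

End passage_time.

(** * Edge-disjoint walks *)

Section disjoint_paths.
Context {d : nat}.
Local Notation vertex := (vertex d).
Local Notation edge := (edge d).
Implicit Types (u v x y z : vertex) (p : seq vertex) (V : set vertex).

(** Twice the midpoint of the edge, which has integer coordinates. Edges are told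
    apart by it more easily than by their endpoints. *)
Definition twice_mid (e : edge) : vertex := \sum_(v <- val e) v.

Fixpoint leg u v n : seq vertex :=
  if n is n'.+1 then (u + v) :: leg (u + v) v n' else [::].

Fixpoint legs_path u (ms : seq (vertex * nat)) : seq vertex :=
  if ms is m :: ms' then leg u m.1 m.2 ++ legs_path (u + m.1 *+ m.2) ms'
  else [::].

(** Along the legs [ms] started at [u], all vertices lie in [V] and all doubled
    midpoints satisfy [C]; the [k]-th edge of a leg in direction [v] has doubled
    midpoint [2 u + (2 k + 1) v]. *)
Fixpoint legs_ok V (C : vertex -> Prop) u (ms : seq (vertex * nat)) : Prop :=
  if ms is m :: ms' then
    [/\ l1norm m.1 = 1%N, forall k, (k <= m.2)%N -> V (u + m.1 *+ k),
        forall k, (k < m.2)%N -> C (u *+ 2 + m.1 *+ k.*2.+1) &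
        legs_ok V C (u + m.1 *+ m.2) ms']
  else True.

Lemma legs_ok_cons V C u v n ms : l1norm v = 1%N ->
  (forall k, (k <= n)%N -> V (u + v *+ k)) ->
  (forall k, (k < n)%N -> C (u *+ 2 + v *+ k.*2.+1)) ->
  legs_ok V C (u + v *+ n) ms -> legs_ok V C u ((v, n) :: ms).
Proof. by []. Qed.

Lemma twice_mid_pair (e : edge) u v : l1norm v = 1%N -> val e = [fset u; (u + v)%R]%fset ->
  twice_mid e = u *+ 2 + v.
Proof.
move=> v1 ve; rewrite /twice_mid ve big_fsetU1 ?big_seq_fset1 /=.
  by rewrite addrA.
rewrite inE -[X in X == _]addr0 (inj_eq (addrI _)).
by apply: contra_eqN v1 => /eqP <-; rewrite l1norm_0.
Qed.

Lemma last_leg u v n : last u (leg u v n) = u + v *+ n.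
Proof. by elim: n u => [|n IH] u /=; rewrite ?mulr0n ?addr0// IH -addrA -mulrS. Qed.

Lemma leg_walk V u v n : l1norm v = 1%N -> (forall k, (k <= n)%N -> V (u + v *+ k)) ->
  walk V u (u + v *+ n) (leg u v n).
Proof.
move=> v1; elim: n u => [|n IH] u hV; rewrite ?mulr0n ?addr0 /=.
  split=> // z; rewrite inE => /eqP ->.
  by have := hV 0%N isT; rewrite mulr0n addr0.
have [|p1 p2 p3] := IH (u + v).
  by move=> k kn; rewrite -addrA -mulrS; exact: hV.
split=> /=.
- by rewrite p1 andbT adjE -l1normN opprB addrC addKr v1.
- by rewrite p2 -addrA -mulrS.
- move=> z; rewrite inE => /orP[/eqP ->|]; last exact: p3.
  by have := hV 0%N isT; rewrite mulr0n addr0.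
Qed.

Lemma leg_edges u v n e : l1norm v = 1%N -> e \in edges u (leg u v n) ->
  exists2 k, (k < n)%N & twice_mid e = u *+ 2 + v *+ k.*2.+1.
Proof.
move=> v1; rewrite mem_edges; elim: n u => // n IH u /=; rewrite inE => /orP[/eqP ve|].
  by exists 0%N => //; rewrite (twice_mid_pair v1 ve).
move=> /IH[k kn ->]; exists k.+1 => //.
by rewrite doubleS mulrnDl -addrA -mulrnDr.
Qed.

Lemma legs_path_ok V C u ms : V u -> legs_ok V C u ms ->
  walk V u (last u (legs_path u ms)) (legs_path u ms) /\
  forall e, e \in edges u (legs_path u ms) -> C (twice_mid e).
Proof.
elim: ms u => [|[v n] ms IH] u Vu /=; first by split=> //; split=> // z; rewrite inE => /eqP ->.
move=> [v1 hV hC /IH[|w1 w2]]; first exact: hV.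
have lw := leg_walk v1 hV.
split; first by rewrite last_cat last_leg; exact: walk_cat lw w1.
move=> e; rewrite edges_cat mem_cat last_leg => /orP[/(leg_edges v1)[k kn ->]|/w2//].
exact: hC.
Qed.

Lemma size_legs_path u ms : size (legs_path u ms) = sumn [seq m.2 | m <- ms].
Proof.
elim: ms u => // [[v n] ms] IH u /=; rewrite size_cat IH; congr (_ + _)%N.
by elim: n u {IH} => //= n IH u; rewrite IH.
Qed.

Lemma last_legs_path u ms :
  last u (legs_path u ms) = u + \sum_(m <- ms) m.1 *+ m.2.
Proof.
elim: ms u => [|[v n] ms IH] u /=; first by rewrite big_nil addr0.
by rewrite last_cat last_leg IH big_cons addrA.
Qed.

Variables (a b : 'I_d) (D : nat).
Hypothesis ab : a != b.

Let ea : vertex := delta_mx 0 a.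
Let eb : vertex := delta_mx 0 b.
Let unit_vec (h : 'I_d * bool) : vertex := (-1) ^+ (~~ h.2) *: delta_mx 0 h.1.

(** One route from [0] to [D ea] for each of the [2d] directions out of [0].
    Direction [+ea] goes straight; a direction [h] transverse to [ea] makes one
    step aside, runs parallel to the axis and steps back; direction [-ea] runs at
    height two in direction [eb], so as to avoid the route of [+eb], and enters
    [D ea] from the far side. *)
Definition detour (h : 'I_d * bool) : seq (vertex * nat) :=
  if h == (a, true) then [:: (ea, D)]
  else if h == (a, false) then
    [:: (- ea, 1%N); (eb, 2%N); (ea, D.+2); (- eb, 2%N); (- ea, 1%N)]
  else [:: (unit_vec h, 1%N); (ea, D); (- unit_vec h, 1%N)].

(** Recovers the route of an edge from its doubled midpoint [s]. The route of
    [-ea] is the only one that leaves the range [0 <= s_a <= 2 D] or has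
    [s_b > 2]. Of the others, only the route of a transverse direction has a
    nonzero transverse coordinate, and that coordinate tells the direction. *)
Definition color (s : vertex) : 'I_d * bool :=
  if [|| s ord0 a < 0, (D.*2)%:Z < s ord0 a | 2 < s ord0 b] then (a, false)
  else if [pick c | (c != a) && (s ord0 c != 0)] is Some c then (c, 0 < s ord0 c)
  else (a, true).

Let l1norm_ea : l1norm ea = 1%N. Proof. exact: l1norm_delta. Qed.
Let l1norm_eb : l1norm eb = 1%N. Proof. exact: l1norm_delta. Qed.

Let eaE i : ea ord0 i = (i == a)%:R. Proof. by rewrite mxE eqxx. Qed.
Let ebE i : eb ord0 i = (i == b)%:R. Proof. by rewrite mxE eqxx. Qed.

Let coordD u v i : (u + v) ord0 i = u ord0 i + v ord0 i. Proof. by rewrite mxE. Qed.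
Let coordN u i : (- u) ord0 i = - u ord0 i. Proof. by rewrite mxE. Qed.
Let coordMn u k i : (u *+ k) ord0 i = u ord0 i *+ k.
Proof. by elim: k => [|k IH]; rewrite ?mulr0n ?mxE// !mulrS coordD IH. Qed.

Let coordE := (coordMn, coordD, coordN, eaE, ebE).

Lemma color_straight (s : vertex) : 0 <= s ord0 a <= (D.*2)%:Z ->
  (forall i, i != a -> s ord0 i = 0) -> color s = (a, true).
Proof.
move=> /andP[s0 s1] h; rewrite /color ltNge s0 ltNge s1 (h b) 1?eq_sym//=.
case: pickP => // c /andP[ca]; rewrite h ?eqxx//.
Qed.

Lemma color_side (s : vertex) c (pos : bool) : c != a -> 0 <= s ord0 a <= (D.*2)%:Z ->
  s ord0 c <= 2 -> s ord0 c != 0 -> (0 < s ord0 c) = pos ->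
  (forall i, i != a -> i != c -> s ord0 i = 0) -> color s = (c, pos).
Proof.
move=> ca /andP[s0 s1] sc2 sc0 sp h; rewrite /color ltNge s0 ltNge s1 /=.
have -> : (2 < s ord0 b) = false.
  apply/negbTE; rewrite -leNgt; have [->//|bc] := eqVneq b c.
  by rewrite h // eq_sym.
case: pickP => [i /andP[ia si]|/(_ c)]; last by rewrite ca sc0.
have [ic|ic] := eqVneq i c; first by rewrite ic sp.
by rewrite h ?eqxx in si.
Qed.

Lemma detour_ok h : legs_ok [set v | `|v ord0 b| <= 2]%N (fun s => color s = h) 0 (detour h).
Proof.
have ba : (b == a) = false by rewrite eq_sym; exact: negbTE.
rewrite /detour; case: (h =P (a, true)) => [->|h1].
  split=> // [k _|k /= kD]; first by rewrite /= !coordE mxE ba; lia.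
  apply: color_straight => [|i /negbTE ia]; rewrite !coordE mxE ?eqxx ?ia; lia.
case: (h =P (a, false)) => [->|h2].
  have far (s : vertex) :
      [|| s ord0 a < 0, (D.*2)%:Z < s ord0 a | 2 < s ord0 b] -> color s = (a, false).
    by rewrite /color => ->.
  have ab' : (a == b) = false by exact: negbTE.
  apply: legs_ok_cons => [|k k1|k k1|].
  - by rewrite l1normN l1norm_ea.
  - by rewrite /mkset !coordE mxE ba ?eqxx; lia.
  - by apply: far; rewrite !coordE !mxE !eqxx ?ab' ?ba; lia.
  apply: legs_ok_cons => [|k k1|k k1|].
  - by rewrite l1norm_eb.
  - by rewrite /mkset !coordE mxE ba ?eqxx; lia.
  - by apply: far; rewrite !coordE !mxE !eqxx ?ab' ?ba; lia.
  apply: legs_ok_cons => [|k k1|k k1|].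
  - by rewrite l1norm_ea.
  - by rewrite /mkset !coordE mxE ba ?eqxx; lia.
  - by apply: far; rewrite !coordE !mxE !eqxx ?ab' ?ba; lia.
  apply: legs_ok_cons => [|k k1|k k1|].
  - by rewrite l1normN l1norm_eb.
  - by rewrite /mkset !coordE mxE ba ?eqxx; lia.
  - by apply: far; rewrite !coordE !mxE !eqxx ?ab' ?ba; lia.
  apply: legs_ok_cons => [|k k1|k k1|//].
  - by rewrite l1normN l1norm_ea.
  - by rewrite /mkset !coordE mxE ba ?eqxx; lia.
  - by apply: far; rewrite !coordE !mxE !eqxx ?ab' ?ba; lia.
case: h h1 h2 => c pos h1 h2.
have ca : c != a by apply/eqP => ca; case: pos h1 h2; rewrite ca.
have uE i : unit_vec (c, pos) ord0 i = (-1) ^+ (~~ pos) * (i == c)%:R.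
  by rewrite !mxE eqxx.
have u1 : l1norm (unit_vec (c, pos)) = 1%N.
  rewrite /unit_vec /=; case: (pos); rewrite ?expr0 ?scale1r ?l1norm_delta//.
  by rewrite expr1 scaleN1r l1normN l1norm_delta.
have ac : (a == c) = false by rewrite eq_sym; exact: negbTE.
have side (s : vertex) : 0 <= s ord0 a <= (D.*2)%:Z -> s ord0 c <= 2 -> s ord0 c != 0 ->
  (0 < s ord0 c) = pos -> (forall i, i != a -> i != c -> s ord0 i = 0) ->
  color s = (c, pos) := @color_side s c pos ca.
apply: legs_ok_cons => [|k k1|k k1|].
- by rewrite u1.
- by rewrite /mkset ?(coordE, uE) !mxE ?ba; case: (pos) => /=; case: (b == c) => /=; lia.
- apply: side; rewrite ?(coordE, uE) ?mxE ?eqxx ?ac ?(negbTE ca); try by case: (pos) => /=; lia.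
  by move=> i /negbTE ia /negbTE ic; rewrite ?(coordE, uE) ?mxE ?ic ?ia; case: (pos) => /=; lia.
apply: legs_ok_cons => [|k k1|k k1|].
- by rewrite l1norm_ea.
- by rewrite /mkset ?(coordE, uE) !mxE ?ba; case: (pos) => /=; case: (b == c) => /=; lia.
- apply: side; rewrite ?(coordE, uE) ?mxE ?eqxx ?ac ?(negbTE ca); try by case: (pos) => /=; lia.
  by move=> i /negbTE ia /negbTE ic; rewrite ?(coordE, uE) ?mxE ?ic ?ia; case: (pos) => /=; lia.
apply: legs_ok_cons => [|k k1|k k1|//].
- by rewrite l1normN u1.
- by rewrite /mkset ?(coordE, uE) !mxE ?ba; case: (pos) => /=; case: (b == c) => /=; lia.
- apply: side; rewrite ?(coordE, uE) ?mxE ?eqxx ?ac ?(negbTE ca); try by case: (pos) => /=; lia.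
  by move=> i /negbTE ia /negbTE ic; rewrite ?(coordE, uE) ?mxE ?ic ?ia; case: (pos) => /=; lia.
Qed.

(** Disjointness comes from [color], a function of the edge that takes the value
    [h] all along the route [h]. *)
Lemma edge_disjoint_walks : exists p : 'I_d * bool -> seq vertex,
  [/\ forall h, walk [set v | `|v ord0 b| <= 2]%N 0 (delta_mx 0 a *+ D) (p h),
      forall h h' e, e \in edges 0 (p h) -> e \in edges 0 (p h') -> h = h' &
      forall h, (size (p h) <= D + 8)%N].
Proof.
exists (fun h => legs_path 0 (detour h)).
have V0 : [set v : vertex | `|v ord0 b| <= 2]%N 0 by rewrite /= mxE.
split.
- move=> h; have [w _] := legs_path_ok V0 (detour_ok h).
  suff <- : last 0 (legs_path 0 (detour h)) = delta_mx 0 a *+ D by [].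
  rewrite last_legs_path add0r /detour; case: ifP => [_|_]; first by rewrite big_seq1.
  case: ifP => _; rewrite !big_cons big_nil /= !mulr1n addr0.
    apply/rowP => i; rewrite -/ea -/eb !coordE.
    by case: (i == a); case: (i == b); lia.
  by rewrite addrC -addrA addNr addr0.
- move=> h h' e eh eh'.
  have [_ ch] := legs_path_ok V0 (detour_ok h).
  have [_ ch'] := legs_path_ok V0 (detour_ok h').
  by rewrite -(ch e eh) (ch' e eh').
- move=> h; rewrite size_legs_path /detour; case: ifP => _ /=; first lia.
  by case: ifP => _ /=; lia.
Qed.

End disjoint_paths.

(** * Mean passage times *)

Section first_passage_means.
Context {R : realType} {d : nat}.
Local Notation edge := (edge d).
Local Notation weights := (@config R edge).
Context (nu : probability R R) (Q : probability weights R).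
Hypothesis lawQ : has_product_law nu Q.
Hypothesis nu2 : has_mean nu (fun x => x ^+ 2).

Let m := mean nu Num.norm.
Let q := mean nu (fun x => x ^+ 2).

Lemma has_mean_norm : has_mean nu Num.norm.
Proof.
apply: (@has_mean_le _ _ _ nu _ (fun x => 1 + x ^+ 2)).
- exact: normr_measurable.
- move=> x; rewrite normr_ge0 /= -real_normK ?num_real//.
  by have := sqr_ge0 (`|x| - 1); have := normr_ge0 x; nra.
- by apply: has_meanD => //; exact: has_mean_cst.
Qed.

Lemma mean_norm_ge0 : 0 <= m.
Proof. exact: mean_ge0. Qed.

(** The Cauchy-Schwarz inequality against the constant one. *)
Lemma sqr_sum_le (s : seq edge) (w : weights) :
  (\sum_(e <- s) `|w e|) ^+ 2 <= (size s)%:R * \sum_(e <- s) (w e) ^+ 2.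
Proof.
elim: s => [|e s IH]; first by rewrite !big_nil mul0r expr0n.
rewrite !big_cons /= -natr1; set S := \sum_(_ <- _) `|_|.
move: IH; rewrite -/S; set S2 := \sum_(_ <- _) _ => IH.
have n0 : (0 : R) <= (size s)%:R by exact: ler0n.
rewrite -[X in X + S2](real_normK (num_real _)); set a := `|w e|.
rewrite sqrrD; have : 2 * a * S <= (size s)%:R * a ^+ 2 + S2; last by rewrite mulr2n; nra.
have [s0|s0] := eqVneq (size s) 0%N.
  by rewrite /S /S2 (size0nil s0) !big_nil mulr0 mul0r addr0.
have n1' : 0 < (size s)%:R :> R by rewrite ltr0n lt0n.
rewrite -(ler_pM2l n1'); apply: le_trans (_ : ((size s)%:R * a) ^+ 2 + S ^+ 2 <= _).
  by have := sqr_ge0 ((size s)%:R * a - S); nra.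
by rewrite mulrDr exprMn expr2 -mulrA lerD2l.
Qed.

Lemma weight_moments (s : seq edge) (w : weights) :
  weight w s <= \sum_(e <- s) `|w e| /\
  (weight w s) ^+ 2 <= (size s)%:R * \sum_(e <- s) (w e) ^+ 2.
Proof.
split; first exact: weight_le_sum.
apply: le_trans (sqr_sum_le s w).
by rewrite lerXn2r ?nnegrE ?weight_ge0 ?sumr_ge0 ?weight_le_sum.
Qed.

(** Source of all moment bounds: a passage time is at most the weight of any one
    walk. *)
Lemma mean_le_weight (f : weights -> R) (s : seq edge) : measurable_fun setT f ->
  (forall w, 0 <= f w <= weight w s) ->
  [/\ has_mean Q f, has_mean Q (fun w => f w ^+ 2),
      mean Q f <= (size s)%:R * m & mean Q (fun w => f w ^+ 2) <= (size s)%:R ^+ 2 * q].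
Proof.
move=> mf fs.
have h1 e : has_mean Q (fun w : weights => `|w e|).
  exact: (has_mean_coord lawQ e has_mean_norm).
have h2 e : has_mean Q (fun w : weights => w e ^+ 2).
  exact: (has_mean_coord lawQ e nu2).
have hs1 : has_mean Q (fun w => \sum_(e <- s) `|w e|) by exact: has_mean_sum.
have hs2 : has_mean Q (fun w => (size s)%:R * \sum_(e <- s) (w e) ^+ 2).
  by apply: has_meanZ => //; exact: has_mean_sum.
have le1 w : 0 <= f w <= \sum_(e <- s) `|w e|.
  have /andP[-> fw] := fs w; exact: le_trans fw (weight_moments s w).1.
have le2 w : 0 <= f w ^+ 2 <= (size s)%:R * \sum_(e <- s) (w e) ^+ 2.
  have /andP[f0 fw] := fs w; rewrite sqr_ge0 /=.
  by apply: le_trans (weight_moments s w).2; rewrite lerXn2r ?nnegrE ?weight_ge0.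
have hf := has_mean_le mf le1 hs1.
have hf2 : has_mean Q (fun w => f w ^+ 2).
  by apply: has_mean_le le2 hs2; exact: measurable_funX.
split=> //.
- apply: (le_trans (mean_le hf hs1 _)); first by move=> w; have /andP[] := le1 w.
  rewrite mean_sum//; under eq_bigr do rewrite (mean_coord lawQ _ has_mean_norm).
  by rewrite big_const_seq count_predT iter_addr_0 mulr_natl.
- apply: (le_trans (mean_le hf2 hs2 _)); first by move=> w; have /andP[] := le2 w.
  rewrite meanZ//; last exact: has_mean_sum.
  rewrite mean_sum//; under eq_bigr do rewrite (mean_coord lawQ _ nu2).
  by rewrite big_const_seq count_predT iter_addr_0 -[X in _ * X]mulr_natl mulrA expr2.
Qed.

Lemma mean_fpt_walk V x y p : walk V x y p ->
  [/\ has_mean Q (fpt V x y), has_mean Q (fun w => fpt V x y w ^+ 2),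
      mean Q (fpt V x y) <= (size p)%:R * m &
      mean Q (fun w => fpt V x y w ^+ 2) <= (size p)%:R ^+ 2 * q].
Proof.
move=> wp; have [||h1 h2 h3 h4] := @mean_le_weight (fpt V x y) (edges x p).
- exact: measurable_fpt.
- by move=> w; rewrite fpt_ge0 fpt_le.
have sp : (size (edges x p))%:R <= (size p)%:R :> R by rewrite ler_nat size_edges.
have q0 : 0 <= q by apply: mean_ge0 => x'; exact: sqr_ge0.
split=> //; first by rewrite (le_trans h3)// ler_wpM2r// mean_norm_ge0.
by rewrite (le_trans h4)// ler_wpM2r// lerXn2r ?nnegrE ?ler0n.
Qed.

Lemma mean_shift z (f : weights -> R) : has_mean Q f ->
  mean Q (fun w => f (w \o eshift z)) = mean Q f.
Proof. exact: (mean_reindex lawQ (eshiftK z) (eshiftNK z)). Qed.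

Lemma has_mean_fpt V x y : has_mean Q (fpt V x y).
Proof.
have [[p /mean_fpt_walk[]//]|/fpt_no_walk ->] := pselect (walk V x y !=set0).
exact: has_mean_cst.
Qed.

Lemma has_mean_fpt2 V x y : has_mean Q (fun w => fpt V x y w ^+ 2).
Proof.
have [[p /mean_fpt_walk[]//]|/fpt_no_walk ->] := pselect (walk V x y !=set0).
by rewrite /= expr0n; exact: has_mean_cst.
Qed.

Lemma mean_fpt_shift z V x y :
  mean Q (fpt [set v | V (v - z)] (x + z) (y + z)) = mean Q (fpt V x y).
Proof.
rewrite -(mean_shift z (has_mean_fpt V x y)); congr mean; apply/funext => w.
exact: fpt_shift.
Qed.

(** By translation invariance the mean passage time depends only on the
    displacement ([mean_fptT]). *)
Definition mean_time (u : vertex d) : R := mean Q (fpt setT 0 u).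

Lemma mean_fptT x y : mean Q (fpt setT x y) = mean_time (y - x).
Proof.
by have := mean_fpt_shift x setT 0 (y - x); rewrite add0r subrK.
Qed.

Lemma mean_time_ge0 u : 0 <= mean_time u.
Proof. by apply: mean_ge0 => w; exact: fpt_ge0. Qed.

Lemma mean_time_le u : mean_time u <= (l1norm u)%:R * m.
Proof.
have [p [wp sp]] := walk_l1ball0 u.
have [_ _ h _] := mean_fpt_walk (walk_sub (@subsetT _ _) wp).
by rewrite (le_trans h)// ler_wpM2r ?mean_norm_ge0// ler_nat.
Qed.

Lemma mean_timeD u v : mean_time (u + v) <= mean_time u + mean_time v.
Proof.
have -> : mean_time v = mean Q (fpt setT u (u + v)) by rewrite mean_fptT addrC addKr.
rewrite -meanD; try exact: has_mean_fpt.
apply: mean_le; [exact: has_mean_fpt|by apply: has_meanD; exact: has_mean_fpt|].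
by move=> w; apply: fpt_triangle; exact: walkT.
Qed.

Lemma mean_time_near u v : mean_time u <= mean_time v + (l1norm (u - v))%:R * m.
Proof.
rewrite -{1}(subrK v u) addrC (le_trans (mean_timeD _ _))// lerD2l.
exact: mean_time_le.
Qed.

Lemma mean_ball_shift K x y :
  mean Q (fpt (l1ball x K) x y) = mean Q (fpt (@l1ball d 0 K) 0 (y - x)).
Proof.
have E : [set v | @l1ball d 0 K (v - x)] = l1ball x K.
  by apply/seteqP; split=> v; rewrite /l1ball /= subr0.
by have := mean_fpt_shift x (@l1ball d 0 K) 0 (y - x); rewrite E add0r subrK => ->.
Qed.

Lemma walk_ball_large u K : (l1norm u <= K)%N -> walk (@l1ball d 0 K) 0 u !=set0.
Proof.
move=> uK; have [p [wp _]] := walk_l1ball0 u; exists p; apply: walk_sub wp => v /= vu.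
by rewrite /l1ball /= subr0 (leq_trans vu).
Qed.

(** Enlarging the ball decreases the restricted passage time to the unrestricted
    one, since each walk lies in some ball; dominated convergence applies. *)
Lemma mean_ball_approx u : exists K, forall K', (K <= K')%N ->
  walk (@l1ball d 0 K') 0 u !=set0 /\ mean Q (fpt (@l1ball d 0 K') 0 u) <= mean_time u + 1.
Proof.
pose K0 := l1norm u.
have ne n : walk (@l1ball d 0 (K0 + n)) 0 u !=set0 by apply: walk_ball_large; exact: leq_addr.
have cv : mean Q (fpt (@l1ball d 0 (K0 + n)) 0 u) @[n --> \oo] --> mean_time u.
  apply: (@mean_decreasing_cvg _ _ _ Q (fun n => fpt (@l1ball d 0 (K0 + n)%N) 0 u)).
  - exact: has_mean_fpt.
  - by move=> n; exact: measurable_fpt.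
  - move=> n w; rewrite fpt_ge0 /=; apply: fpt_mono; last exact: ne.
    by apply: l1ball_sub; rewrite addn0 leq_addr.
  - move=> w; apply/cvgrPdist_lt => e e0.
    have [p wp lp] : exists2 p, walk setT 0 u p & weight w (edges 0 p) < fpt setT 0 u w + e.
      by apply: fpt_lt; [exact: walkT|rewrite ltrDl].
    exists (\sum_(v <- 0%R :: p) l1norm v)%N => // n /= np.
    have wn : walk (@l1ball d 0 (K0 + n)) 0 u p.
      have [p1 p2 p3] := wp; split=> // v vp; rewrite /l1ball /= subr0.
      rewrite (leq_trans _ (leq_addl _ _))// (leq_trans _ np)//.
      by rewrite (big_rem v)//= leq_addr.
    have h1 := fpt_le w wn; have h2 : fpt setT 0 u w <= fpt (@l1ball d 0 (K0 + n)) 0 u w.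
      by apply: fpt_mono.
    by rewrite ltr_norml; apply/andP; split; lra.
have [|K _ hK] := (@cvgrPdist_lt _ _ _ _ _ _ _).1 cv 1; first exact: ltr01.
exists (K0 + K)%N => K' KK'; split.
  by apply: walk_ball_large; apply: leq_trans KK'; exact: leq_addr.
have := hK (K' - K0)%N; rewrite /= subnKC ?(leq_trans _ KK') ?leq_addr//.
rewrite leq_subRL ?(leq_trans _ KK') ?leq_addr// => /(_ isT).
by rewrite ltr_norml => /andP[h _]; lra.
Qed.

End first_passage_means.

(** * The time constant *)

Section fekete.
Context {R : realType}.

Lemma euclid_real (t m : R) : 0 <= t -> 0 < m ->
  exists (k : nat) (s : R), [/\ t = k%:R * m + s, 0 <= s & s < m].
Proof.
move=> t0 m0; pose k := Num.truncn (t / m).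
have /andP[k1 k2] := @Num.Theory.truncn_itv R (t / m) (divr_ge0 t0 (ltW m0)).
exists k, (t - k%:R * m); split; first by rewrite addrC subrK.
- by rewrite subr_ge0 -ler_pdivlMr.
- by rewrite ltrBlDl; move: k2; rewrite ltr_pdivrMr// -natr1 -/k; lra.
Qed.

(** The Fekete lemma for functions of a real variable that are subadditive up to a
    constant: [f + C] is subadditive, and the limit is the infimum of
    [(f t + C) / t]. *)
Lemma fekete_real (f : R -> R) (C D : R) : 0 <= C -> 0 <= D ->
  (forall t, 0 <= t -> 0 <= f t <= D * (t + 1)) ->
  (forall s t, 0 <= s -> 0 <= t -> f (s + t) <= f s + f t + C) ->
  exists mu : R, t^-1 * f t @[t --> +oo] --> mu /\
    forall t, 0 < t -> t * mu <= f t + C.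
Proof.
move=> C0 D0 f0 fD.
pose E := [set (f t + C) / t | t in [set t | 0 < t]].
have E0 : lbound E 0.
  move=> _ [t t0 <-]; rewrite /= in t0; rewrite divr_ge0 ?(ltW t0)//.
  by rewrite addr_ge0//; have /andP[] := f0 t (ltW t0).
have nE : E !=set0 by exists ((f 1 + C) / 1); exists 1 => //=.
have hE : has_inf E by split=> //; exists 0.
have mule t : 0 < t -> t * inf E <= f t + C.
  move=> t0; rewrite mulrC -ler_pdivlMr//; apply: ge_inf; first by exists 0.
  by exists t.
exists (inf E); split=> //.
apply/cvgrPdist_lt => e e0.
have e2 : 0 < e / 2 by rewrite divr_gt0.
have [_ [m m0 <-] hm] := inf_adherent e2 hE.
rewrite /= in m0; set mu := inf E in hm mule *.
pose B := D * (m + 1) + C.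
have B0 : 0 <= B by rewrite addr_ge0// mulr_ge0// addr_ge0// ltW.
have fk k s : 0 <= s -> f (k%:R * m + s) <= k%:R * (f m + C) + f s.
  move=> s0; elim: k => [|k IH]; first by rewrite !mul0r !add0r.
  rewrite -natr1 mulrDl mul1r -addrA (addrC m) addrA.
  apply: (le_trans (fD _ _ _ (ltW m0))); first by rewrite addr_ge0// mulr_ge0// ltW.
  by rewrite mulrDl mul1r; lra.
(* past this point, [B / t] and [C / t] are both below [e / 2] *)
exists (2 * (B + C + 1) / e); split; first exact: num_real.
move=> t; rewrite ltr_pdivrMr// => te.
have t0 : 0 < t.
  rewrite -(pmulr_lgt0 _ e0) (le_lt_trans _ te)// mulr_ge0// addr_ge0// addr_ge0//.
have [k [s [ts s0 sm]]] := euclid_real (ltW t0) m0.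
have h1 : f t <= k%:R * (f m + C) + f s by rewrite ts; exact: fk.
have h2 : f s + C <= B.
  have /andP[_ fs] := f0 s s0; rewrite lerD2r (le_trans fs)// ler_wpM2l// lerD2r ltW//.
have h3 : k%:R * m <= t by rewrite ts lerDl.
have fm : f m + C <= (mu + e / 2) * m by rewrite -ler_pdivrMr// ltW.
have h4 : f t <= t * (mu + e / 2) + B.
  have mu0 : 0 <= mu + e / 2 by rewrite addr_ge0 ?(ltW e2)//; exact: lb_le_inf.
  have : k%:R * (f m + C) <= k%:R * ((mu + e / 2) * m) by rewrite ler_wpM2l.
  have : (mu + e / 2) * (k%:R * m) <= (mu + e / 2) * t by rewrite ler_wpM2l.
  by nra.
have h5 := mule t t0.
rewrite ltr_norml; apply/andP; split.
- rewrite ltrBrDr -(ltr_pM2l t0) mulrDr mulrA mulfV ?gt_eqF// mul1r; nra.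
- rewrite ltrBlDr -(ltr_pM2l t0) mulrDr mulrA mulfV ?gt_eqF// mul1r; nra.
Qed.

End fekete.

Section ray.
Context {R : realType} {d : nat} (x : 'rV[R]_d).

Definition ray (t : R) : vertex d := floor_vertex (t *: x).

Definition norm1 : R := \sum_(i < d) `|x ord0 i|.

Lemma norm1_ge0 : 0 <= norm1. Proof. exact: sumr_ge0. Qed.

Lemma ray_coord t i : t * x ord0 i - 1 < (ray t ord0 i)%:~R <= t * x ord0 i.
Proof.
rewrite /ray /floor_vertex !mxE.
by have /andP[-> h] := Num.Theory.floor_itv (t * x ord0 i); rewrite intrD in h; lra.
Qed.

Lemma floor_vertex0 : floor_vertex (0 : 'rV[R]_d) = 0.
Proof. by apply/rowP => i; rewrite !mxE Num.Theory.floor0. Qed.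

Lemma ray0 : ray 0 = 0.
Proof. by rewrite /ray scale0r floor_vertex0. Qed.

Lemma absz_real (z : int) : (`|z|%N)%:R = `|z%:~R| :> R.
Proof. by rewrite -intr_norm natr_absz. Qed.

Lemma l1norm_ray_sub s t : (l1norm (ray s - ray t))%:R <= `|s - t| * norm1 + d%:R.
Proof.
rewrite /l1norm natr_sum /norm1 mulr_sumr.
have -> : d%:R = \sum_(i < d) 1 :> R by rewrite sumr_const card_ord.
rewrite -big_split /=; apply: ler_sum => i _; rewrite absz_real !mxE.
have := ray_coord s i; have := ray_coord t i; rewrite !mxE intrD rmorphN /=.
move=> /andP[t1 t2] /andP[s1 s2].
rewrite -normrM mulrBl.
have := ler_norm (s * x ord0 i - t * x ord0 i); have := ler_norm (- (s * x ord0 i - t * x ord0 i)).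
by rewrite normrN ler_norml => *; apply/andP; split; lra.
Qed.

(** [floor (p + q) - floor p - floor q] is [0] or [1]. *)
Lemma l1norm_ray_add s t : (l1norm (ray (s + t)%R - ray s - ray t)%R <= d)%N.
Proof.
rewrite /l1norm -[X in (_ <= X)%N]card_ord -sum1_card; apply: leq_sum => i _.
have := ray_coord s i; have := ray_coord t i; have := ray_coord (s + t) i.
rewrite !mxE; set a := Num.floor _; set b := Num.floor _; set c := Num.floor _.
move=> /andP[a1 a2] /andP[b1 b2] /andP[c1 c2].
have h1 : -1 < (a - c - b)%:~R :> R by rewrite !rmorphB /=; lra.
have h2 : (a - c - b)%:~R < 2 :> R by rewrite !rmorphB /=; lra.
have : -1 < a - c - b by rewrite -(ltr_int R) rmorphN.
have : a - c - b < 2 by rewrite -(ltr_int R).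
by lia.
Qed.

Lemma l1norm_ray_lower i s t :
  `|s - t| * `|x ord0 i| - 1 <= (l1norm (ray s - ray t))%:R.
Proof.
apply: le_trans (_ : (`|(ray s - ray t)%R ord0 i|%N)%:R <= _); last by rewrite ler_nat l1norm_coord.
rewrite absz_real; have := ray_coord s i; have := ray_coord t i; rewrite !mxE intrD rmorphN /=.
move=> /andP[t1 t2] /andP[s1 s2]; rewrite -normrM mulrBl.
set u := _%:~R in s1 s2 *; set v := _%:~R in t1 t2 *.
rewrite lerBlDr; have -> : s * x ord0 i - t * x ord0 i =
    (u - v) + (s * x ord0 i - u - (t * x ord0 i - v)) by lra.
rewrite (le_trans (ler_normD _ _))// lerD2l ler_norml; apply/andP; split; lra.
Qed.

End ray.

Section time_constant.
Context {R : realType} {d : nat}.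
Local Notation weights := (@config R (edge d)).
Context (nu : probability R R) (Q : probability weights R).
Hypothesis lawQ : has_product_law nu Q.
Hypothesis nu2 : has_mean nu (fun x => x ^+ 2).
Variable x : 'rV[R]_d.

Let m := mean nu Num.norm.

Lemma mean_time_ray_increment s t :
  mean_time Q (ray x (s + t) - ray x s) <= mean_time Q (ray x t) + d%:R * m.
Proof.
apply: (le_trans (mean_time_near lawQ nu2 _ (ray x t))).
rewrite lerD2l ler_wpM2r ?mean_ge0// ler_nat.
exact: l1norm_ray_add.
Qed.

(** Besides the limit, the bound [t mu <= E T + O(1)] for every [t] is what makes
    the second moment method work at the exact level [mu]. *)
Lemma time_constant_exists : exists mu : R,
  t^-1 * mean_time Q (ray x t) @[t --> +oo] --> mu /\
  forall t, 0 < t -> t * mu <= mean_time Q (ray x t) + d%:R * m.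
Proof.
have m0 : 0 <= m by exact: mean_ge0.
apply: (@fekete_real R _ _ ((norm1 x + d%:R) * m)).
- by rewrite mulr_ge0.
- by rewrite mulr_ge0// addr_ge0// norm1_ge0.
- move=> t t0; rewrite mean_time_ge0 /=.
  rewrite (le_trans (mean_time_le lawQ nu2 _))// mulrAC ler_wpM2r//.
  have := l1norm_ray_sub x t 0; rewrite ray0 !subr0 ger0_norm// => /le_trans; apply.
  by have := norm1_ge0 x; have : (0 : R) <= d%:R := ler0n _ _; nra.
- move=> s t s0 t0; have := mean_time_ray_increment s t.
  have := mean_timeD lawQ nu2 (ray x s) (ray x (s + t) - ray x s).
  by rewrite addrC subrK; lra.
Qed.

End time_constant.

(** * Lower bound *)

Section star.
Context {R : realType} {d : nat}.
Local Notation weights := (@config R (edge d)).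

(** The edges at the origin. *)
Definition star : seq (edge d) := undup (pmap insub
  [seq [fset 0; (-1) ^+ (h.2 : bool) *: delta_mx 0 h.1]%fset | h : 'I_d * bool]).

Lemma star_uniq : uniq star. Proof. exact: undup_uniq. Qed.

Lemma size_star : (size star <= 2 * d)%N.
Proof.
rewrite (leq_trans (size_undup _))// size_pmap (leq_trans (count_size _ _))//.
by rewrite size_map -cardE card_prod card_ord card_bool mulnC.
Qed.

Lemma unit_vertex (v : vertex d) : l1norm v = 1%N ->
  exists h : 'I_d * bool, v = (-1) ^+ h.2 *: delta_mx 0 h.1.
Proof.
move=> v1.
have [i vi] : exists i, v ord0 i != 0.
  apply/existsP; rewrite -negb_forall; apply: contra_eqN v1 => /forallP h.
  by rewrite /l1norm big1// => i _; rewrite (eqP (h i)).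
have vj j : j != i -> v ord0 j = 0.
  move=> ji; apply/eqP; rewrite -absz_eq0; move: v1.
  rewrite /l1norm (bigD1 i)//= (bigD1 j)//=.
  by move: (\sum_(_ < d | _) _)%N => s; move: (v ord0 i) vi (v ord0 j); lia.
have vi1 : `|v ord0 i|%N = 1%N.
  by move: v1; rewrite /l1norm (bigD1 i)//= big1 ?addn0// => j ji; rewrite vj.
exists (i, v ord0 i < 0); apply/rowP => j; rewrite !mxE eqxx -[v 0 j]/(v ord0 j) /=.
have [->|ji] := eqVneq j i; last by rewrite mulr0 vj.
by move: (v ord0 i) vi1 => z z1; rewrite mulr1; case: ltP => z0; rewrite ?expr1 ?expr0; lia.
Qed.

Lemma starP (e : edge d) : 0 \in val e -> e \in star.
Proof.
move=> e0; rewrite mem_undup mem_pmap_sub.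
have /asboolP[u [v [uv ve]]] := valP e.
have [v' [v1 ve']] : exists v' : vertex d, l1norm v' = 1%N /\ val e = [fset 0; v']%fset.
  move: e0 uv; rewrite ve !inE adjE => /orP[]/eqP<-.
    by rewrite sub0r l1normN => /eqP; exists v.
  by rewrite subr0 => /eqP; exists u; split=> //; rewrite fsetUC.
have [h hv] := unit_vertex v1; apply/mapP; exists h; first by rewrite mem_enum.
by rewrite ve' hv.
Qed.

(** Erasing the edges at the origin makes the configuration independent of them. *)
Definition unstar (w : weights) : weights := fun e => if e \in star then 0 else w e.

(** A path out of [0] uses an edge of the star, whose weight is lost in
    [unstar w]. *)
Lemma fpt_unstar_ge (y : vertex d) (w : weights) (A : R) : y != 0 -> 0 <= A ->
  (forall e, e \in star -> A <= w e) ->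
  A + fpt setT 0 y (unstar w) <= fpt setT 0 y w.
Proof.
move=> y0 A0 hA; apply: fpt_ge; first exact: walkT.
move=> [|v p] wp; first by have [_ /= y00 _] := wp; rewrite -y00 eqxx in y0.
apply: (@le_trans _ _ (A + weight (unstar w) (edges 0 (v :: p)))).
  by rewrite lerD2l; exact: fpt_le.
have [/= /andP[v1 _] _ _] := wp.
have ve : is_edge [fset 0; v]%fset by apply/asboolP; exists 0, v.
pose e1 : edge d := Sub _ ve.
have e1E : e1 \in edges 0 (v :: p) by rewrite mem_edges /= inE eqxx.
have e1s : e1 \in star by apply: starP; rewrite !inE eqxx.
rewrite /weight (bigD1_seq e1) ?mem_undup ?undup_uniq//=.
rewrite [leRHS](bigD1_seq e1) ?mem_undup ?undup_uniq//=.
rewrite {1}/unstar e1s normr0 add0r; apply: lerD.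
  by rewrite (le_trans (hA _ e1s))// ler_norm.
by apply: ler_sum => e _; rewrite /unstar; case: ifP => _ //; rewrite normr0.
Qed.

Lemma fpt_unstar_le (y : vertex d) (w : weights) :
  fpt setT 0 y (unstar w) <= fpt setT 0 y w.
Proof.
apply: fpt_ge; first exact: walkT.
move=> p wp; apply: (le_trans (fpt_le _ wp)); apply: ler_sum => e _.
by rewrite /unstar; case: ifP => _ //; rewrite normr0.
Qed.

Lemma fpt_le_unstar (y : vertex d) (w : weights) :
  fpt setT 0 y w <= fpt setT 0 y (unstar w) + \sum_(e <- star) `|w e|.
Proof.
rewrite -lerBlDr; apply: fpt_ge; first exact: walkT.
move=> p wp; rewrite lerBlDr; apply: (le_trans (fpt_le _ wp)).
rewrite /weight [leLHS](bigID (mem star)) /= addrC; apply: lerD.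
  rewrite [leRHS](bigID (mem star)) /= ler_wpDl ?sumr_ge0//.
  by apply: ler_sum => e es; rewrite /unstar (negbTE es).
pose s := [seq e <- undup (edges 0 p) | e \in star].
rewrite (_ : \sum_(_ <- _ | _) _ = \sum_(e <- s) `|w e|); last by rewrite -big_filter.
have us : undup s = s by rewrite undup_id// filter_uniq// undup_uniq.
have ss : {subset s <= star} by move=> e; rewrite mem_filter => /andP[].
by have := weight_subset w ss; rewrite /weight us undup_id// star_uniq.
Qed.

Lemma measurable_unstar : measurable_fun setT unstar.
Proof.
apply: measurable_config => e; rewrite /unstar; case: (e \in star).
  exact: measurable_cst.
exact: measurable_coord.
Qed.

End star.

Section lower_bound.
Context {R : realType} {d : nat}.
Local Notation weights := (@config R (edge d)).
Context (nu : probability R R) (Q : probability weights R).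
Hypothesis lawQ : has_product_law nu Q.
Hypothesis nu2 : has_mean nu (fun x => x ^+ 2).
Variables (x : 'rV[R]_d) (b : 'I_d).
Hypothesis xb : x ord0 b != 0.
Variable mu : R.
Hypothesis mu_le : forall t, 0 < t ->
  t * mu <= mean_time Q (ray x t) + d%:R * mean nu Num.norm.

Lemma prob_coord_gt (A : R) (e : edge d) :
  Q [set w | A < w e] = nu `]A, +oo[%classic.
Proof.
transitivity (Q (cylinder [fset e]%fset (fun=> `]A, +oo[%classic))).
  congr (Q _); apply/seteqP; split=> w /=.
    by move=> h j /=; rewrite inE => /eqP ->; rewrite in_itv /= h.
  by move/(_ e); rewrite /= inE in_itv /= andbT; apply.
by rewrite lawQ// big_seq_fset1.
Qed.

(** Erasing the star lowers the mean only by a constant, so the mean is still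
    [n mu - O(1)] and the second moment [O(n^2)]. *)
Lemma unstar_positive (e : R) : 0 < e -> exists2 c : R, 0 < c &
  \forall n \near \oo, c <= fine (Q [set w |
    n%:R * Num.max (mu - e) 0 <= fpt setT 0 (ray x n%:R) (unstar w)]).
Proof.
move=> e0; set m := mean nu Num.norm; set q := mean nu (fun x => x ^+ 2).
have m0 : 0 <= m by exact: mean_ge0.
have q0 : 0 <= q by apply: mean_ge0 => z; exact: sqr_ge0.
have [mue|mue] := leP mu e.
  exists 1; first exact: ltr01.
  near=> n; rewrite (_ : [set w | _] = setT) ?probability_setT//.
  apply/seteqP; split=> // w _ /=.
  rewrite (_ : Num.max _ _ = 0) ?mulr0 ?fpt_ge0//; apply/max_idPr; lra.
pose X := norm1 x + d%:R; pose B := X ^+ 2 * q + 1.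
have X0 : 0 <= X by rewrite addr_ge0// norm1_ge0.
have B0 : 0 < B by rewrite ltr_pwDr// mulr_ge0// sqr_ge0.
pose C := d%:R * m + (2 * d)%:R * m.
have C0 : 0 <= C by rewrite addr_ge0// mulr_ge0.
exists (e ^+ 2 / (4 * B)); first by rewrite divr_gt0 ?exprn_gt0// mulr_gt0.
near=> n.
have n0 : (0 : R) < n%:R by rewrite ltr0n; near: n; exact: nbhs_infty_gt.
have n1' : (1 : R) <= n%:R by rewrite ler1n -(ltr0n R).
have nC : C <= n%:R * (e / 2).
  rewrite -ler_pdivrMr ?divr_gt0//; near: n; exact: nbhs_infty_ger.
pose y := ray x n%:R.
pose Z (w : weights) := fpt setT 0 y (unstar w).
have hT : has_mean Q (fpt setT 0 y) by exact: (has_mean_fpt lawQ nu2).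
have hT2 : has_mean Q (fun w => fpt setT 0 y w ^+ 2) by exact: (has_mean_fpt2 lawQ nu2).
have mZ : measurable_fun setT Z.
  exact: (measurableT_comp (measurable_fpt _ _ _) measurable_unstar).
have hZ : has_mean Q Z.
  by apply: has_mean_le mZ _ hT => w; rewrite fpt_ge0 fpt_unstar_le.
have leZ2 w : 0 <= Z w ^+ 2 <= fpt setT 0 y w ^+ 2.
  by rewrite sqr_ge0 lerXn2r ?nnegrE ?fpt_ge0// fpt_unstar_le.
have hZ2 : has_mean Q (fun w => Z w ^+ 2).
  by apply: has_mean_le leZ2 hT2; exact: measurable_funX.
have yn : (l1norm y)%:R <= n%:R * X.
  have := l1norm_ray_sub x n%:R 0; rewrite ray0 !subr0 ger0_norm// => /le_trans; apply.
  by rewrite /X mulrDr lerD2l ler_peMl.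
have mZ2 : mean Q (fun w => Z w ^+ 2) <= n%:R ^+ 2 * B.
  apply: (le_trans (mean_le hZ2 hT2 _)); first by move=> w; have /andP[] := leZ2 w.
  have [p [wp sp]] := walk_l1ball0 y.
  have [_ _ _ h] := mean_fpt_walk lawQ nu2 (walk_sub (@subsetT _ _) wp).
  apply: (le_trans h); apply: (@le_trans _ _ ((n%:R * X) ^+ 2 * q)).
    rewrite ler_wpM2r// lerXn2r ?nnegrE ?mulr_ge0// (le_trans _ yn)//.
    by rewrite ler_nat.
  by rewrite exprMn -mulrA ler_wpM2l ?sqr_ge0// /B lerDl.
have meanZ_ge : n%:R * mu - C <= mean Q Z.
  have hs : has_mean Q (fun w : weights => \sum_(e <- star) `|w e|).
    by apply: has_mean_sum => f; exact: (has_mean_coord lawQ f (has_mean_norm nu2)).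
  have h1 : mean Q (fpt setT 0 y) <= mean Q Z + (2 * d)%:R * m.
    have hD := has_meanD hZ hs.
    apply: (le_trans (mean_le hT hD _)); first by move=> w; exact: fpt_le_unstar.
    rewrite meanD// lerD2l mean_sum; last first.
      by move=> f; exact: (has_mean_coord lawQ f (has_mean_norm nu2)).
    under eq_bigr do rewrite (mean_coord lawQ _ (has_mean_norm nu2)).
    rewrite big_const_seq count_predT iter_addr_0 -[leLHS]mulr_natl ler_wpM2r//.
    by rewrite ler_nat size_star.
  by have := mu_le n0; rewrite /C -/m /mean_time -/y; lra.
have maxE : Num.max (mu - e) 0 = mu - e by apply/max_idPl; lra.
(* this parameter makes the second moment term at most [n e / 4] *)
have l0 : 0 < e / (4 * B * n%:R) by rewrite divr_gt0// !mulr_gt0.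
have a0 : 0 <= n%:R * (mu - e) by rewrite mulr_ge0//; lra.
have := paley_zygmund hZ hZ2 a0 l0; rewrite maxE -/y.
set p := fine _ => h.
have : e / (4 * B * n%:R) * mean Q (fun w => Z w ^+ 2) <= n%:R * e / 4.
  apply: le_trans (_ : e / (4 * B * n%:R) * (n%:R ^+ 2 * B) <= _).
    by rewrite ler_wpM2l// ltW.
  rewrite le_eqVlt; apply/orP; left; apply/eqP; field.
  by rewrite !gt_eqF.
have -> : e ^+ 2 / (4 * B) = (n%:R * e / 4) / (n%:R * B / e).
  by field; rewrite !gt_eqF.
rewrite ler_pdivrMr ?divr_gt0 ?mulr_gt0//.
have -> : p * (n%:R * B / e) = p / (4 * (e / (4 * B * n%:R))).
  by field; rewrite !gt_eqF.
by lra.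
Unshelve. all: by end_near.
Qed.

(** The star is blocked at level [n (xi + 2 e)] while the rest of the
    configuration takes at least [n (mu - e)]; the spare [n e] makes the
    inequality strict. *)
Theorem lower_bound (xi e : R) : 0 < xi -> 0 < e -> exists2 c : R, 0 < c &
  \forall n \near \oo, c * fine (nu `]n%:R * (xi + 2 * e), +oo[%classic) ^+ (2 * d) <=
    fine (Q [set w | n%:R * (mu + xi) < fpt setT 0 (ray x n%:R) w]).
Proof.
move=> xi0 e0; have [c c0 hc] := unstar_positive e0; exists c => //.
near=> n.
have n0 : (0 : R) < n%:R by rewrite ltr0n; near: n; exact: nbhs_infty_gt.
have hcn : c <= fine (Q [set w |
    n%:R * Num.max (mu - e) 0 <= fpt setT 0 (ray x n%:R) (unstar w)]).
  by near: n; exact: hc.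
have y0 : ray x n%:R != 0.
  apply/eqP => y0; have := l1norm_ray_lower x b n%:R 0; rewrite y0 ray0 !subr0 l1norm_0 ger0_norm//.
  rewrite lerBlDr add0r leNgt => /negP; apply.
  rewrite -ltr_pdivrMr ?normr_gt0//; near: n; exact: nbhs_infty_gtr.
pose y := ray x n%:R; pose A := n%:R * (xi + 2 * e).
have A0 : 0 <= A by rewrite mulr_ge0// addr_ge0 ?mulr_ge0// ltW.
pose E1 : set weights := [set w | forall f, f \in star -> A < w f].
pose E2 : set weights := [set w | n%:R * Num.max (mu - e) 0 <= fpt setT 0 y (unstar w)].
have mA f : measurable [set w : weights | A < w f].
  by apply: measurable_gt; exact: measurable_coord.
have [mE1 pE1] := prob_bigcap_indep lawQ (F := fun f => [set f]) star_uniq mA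
  (fun f w w' ww' => congr1 (fun z : R => A < z : Prop) (ww' f erefl))
  (fun i j z _ _ zi zj => etrans (esym zi) zj).
have mE2 : measurable E2.
  apply: measurable_ge.
  exact: (measurableT_comp (measurable_fpt _ _ _) measurable_unstar).
have dE1 : depends_on [set f | f \in star] (\1_E1 : weights -> R).
  move=> w w' ww'; rewrite !indicE; congr (nat_of_bool _)%:R.
  by apply/idP/idP; rewrite !inE => h f fs; have := h f fs; rewrite ww'.
have dE2 : depends_on (~` [set f | f \in star]) (\1_E2 : weights -> R).
  move=> w w' ww'; rewrite !indicE; congr (nat_of_bool _)%:R.
  have -> // : (w \in E2) = (w' \in E2).
  apply/idP/idP; rewrite !inE /E2 /=; (have -> // : unstar w = unstar w');
    by apply/funext => f; rewrite /unstar; case: ifPn => // fs; apply: ww' => /=; exact/negP.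
have [_ pE12] := mean_mul_indep lawQ
   (has_mean_indic Q mE1) (has_mean_indic Q mE2) dE1 dE2.
have mE12 := measurableI _ _ mE1 mE2.
apply: (@le_trans _ _ (fine (Q (E1 `&` E2)))); last first.
  apply: prob_le => //; first by apply: measurable_gt; exact: measurable_fpt.
  move=> w [/= h1 h2]; have := fpt_unstar_ge y0 A0 (fun f fs => ltW (h1 f fs)).
  apply: lt_le_trans; rewrite -/y.
  apply: lt_le_trans (_ : A + n%:R * Num.max (mu - e) 0 <= _); last by rewrite lerD2l.
  rewrite /A -mulrDr ltr_pM2l//.
  have : mu - e <= Num.max (mu - e) 0 by rewrite le_max lexx.
  lra.
rewrite -[leRHS]mean_indic//.
have -> : mean Q \1_(E1 `&` E2) = mean Q (fun w => \1_E1 w * \1_E2 w).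
  by congr mean; apply/funext => w; rewrite indicI.
rewrite pE12.
rewrite !mean_indic// mulrC pE1; apply: ler_pM.
- by rewrite exprn_ge0// fine_ge0.
- exact: ltW.
- under eq_bigr do rewrite prob_coord_gt.
  rewrite big_const_seq count_predT iter_mulr_1 ler_wiXn2l ?fine_ge0 ?size_star//.
  by rewrite -lee_fin fineK ?fin_num_measure// probability_le1.
- exact: hcn.
Unshelve. all: by end_near.
Qed.

End lower_bound.

(** * Law of large numbers in a tube *)

Section tube.
Context {R : realType} {d : nat}.
Local Notation weights := (@config R (edge d)).

(** A ball of the lattice is finite, so finitely many thresholds have a maximum. *)
Lemma uniform_on_ball (A : vertex d -> nat -> Prop) :
  (forall u, exists K, forall K', (K <= K')%N -> A u K') ->
  forall U, exists K, forall u K', (l1norm u <= U)%N -> (K <= K')%N -> A u K'.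
Proof.
move=> /choice[k hk] U.
pose vec (f : {ffun 'I_d -> 'I_(2 * U).+1}) : vertex d := \row_i ((f i)%:Z - U%:Z).
exists (\max_(f : {ffun 'I_d -> 'I_(2 * U).+1}) k (vec f))%N => u K' uU KK'; apply: hk.
have -> : u = vec [ffun i => inord `|(u ord0 i + U%:Z)%R|%N].
  apply/rowP => i; rewrite mxE ffunE -[u 0 i]/(u ord0 i).
  have := leq_trans (l1norm_coord u i) uU; move: (u ord0 i) => z zU.
  by rewrite inordK; lia.
exact: leq_trans (leq_bigmax _) KK'.
Qed.

Context (nu : probability R R) (Q : probability weights R).
Hypothesis lawQ : has_product_law nu Q.
Hypothesis nu2 : has_mean nu (fun x => x ^+ 2).
Variables (x : 'rV[R]_d) (b : 'I_d).
Hypothesis xb : x ord0 b != 0.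
Variable mu : R.
Hypothesis cvg_mu : t^-1 * mean_time Q (ray x t) @[t --> +oo] --> mu.

Lemma edge_vertex (e : edge d) : exists v, v \in val e.
Proof.
have /asboolP[u [v [_ ->]]] := valP e; exists u.
by rewrite !inE eqxx.
Qed.

Lemma inside_disjoint (V V' : set (vertex d)) : V `&` V' `<=` set0 ->
  inside V `<=` ~` inside V'.
Proof.
by move=> VV' e eV eV'; have [v ve] := edge_vertex e; apply: (VV' v); split; [exact: eV|exact: eV'].
Qed.

Lemma tube_chain V (v : nat -> vertex d) (K k : nat) :
  (forall j, walk (l1ball (v j) K) (v j) (v j.+1) !=set0) ->
  (forall j, l1ball (v j) K `<=` V) -> v 0%N = 0 ->
  walk V 0 (v k) !=set0 /\
  forall w : weights, fpt V 0 (v k) w <= \sum_(j < k) fpt (l1ball (v j) K) (v j) (v j.+1) w.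
Proof.
move=> hw hV v0; elim: k => [|k [[p wp] IH]].
  rewrite v0; have w0 : walk V 0 0 [::].
    split=> // u; rewrite inE => /eqP ->; apply: (hV 0%N).
    by rewrite v0 /l1ball /= subrr l1norm_0.
  split; first by exists [::].
  move=> w; rewrite big_ord0 (le_trans (fpt_le w w0))//.
  by rewrite /weight big_nil.
have [q wq] := hw k; have wq' := walk_sub (hV k) wq.
split; first by exists (p ++ q); exact: walk_cat wp wq'.
move=> w; rewrite big_ord_recr /=.
apply: (le_trans (fpt_triangle w (ex_intro _ p wp) (ex_intro _ q wq'))).
apply: lerD; first exact: IH.
by apply: fpt_mono; [exact: hV|exists q].
Qed.

(** The segment from [0] to [n x] is cut into [k] pieces of length [t] between [M]
    and [2 M], and consecutive lattice points are joined inside balls of radius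
    [K]. Each piece has mean at most [t (mu + e/3) + C] and second moment at most
    [B]; pieces at index distance at least [q] live in disjoint balls.
    The displacements range over a finite set, which is why one [K] suits all. *)
Theorem tube_law_of_large_numbers (e : R) : 0 < e -> exists K : nat,
  forall V : set (vertex d), (forall t, 0 <= t -> l1ball (ray x t) K `<=` V) ->
  (\forall n \near \oo, walk V 0 (ray x n%:R) !=set0) /\
  fine (Q [set w | n%:R * (mu + e) < fpt V 0 (ray x n%:R) w]) @[n --> \oo] --> (0 : R).
Proof.
move=> e0; set m := mean nu Num.norm.
pose C := d%:R * m + 1.
have m0 : 0 <= m by exact: mean_ge0.
have C1 : 1 <= C by rewrite /C lerDr mulr_ge0.
have e3 : 0 < e / 3 by rewrite divr_gt0.
(* pieces of length [M] have mean close to [M mu] and absorb the cost [C] of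
   rounding and of restricting to a ball *)
have [M [M0 MC hM]] : exists M : nat, [/\ (0 < M)%N, C <= e / 3 * M%:R &
    forall t, M%:R <= t -> mean_time Q (ray x t) <= t * (mu + e / 3)].
  have [t1 [t1r ht1]] := (@cvgrPdist_lt _ _ _ _ _ _ _).1 cvg_mu _ e3.
  have Ce : 0 <= C / (e / 3) by rewrite divr_ge0 ?(ltW e3)// (le_trans _ C1).
  pose M := (Num.truncn (`|t1| + C / (e / 3))).+1.
  have hM : `|t1| + C / (e / 3) < M%:R.
    by have /andP[] := Num.Theory.truncn_itv (addr_ge0 (normr_ge0 t1) Ce).
  exists M; split=> //.
    by rewrite mulrC -ler_pdivrMr//; have := normr_ge0 t1; lra.
  move=> t Mt; have t0 : 0 < t by have := normr_ge0 t1; lra.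
  have tt : t1 < t by have := ler_norm t1; lra.
  have := ht1 t tt; rewrite /= ltr_norml => /andP[h _].
  by rewrite -ler_pdivrMl// ; lra.
pose U := ((Num.truncn (2 * M%:R * norm1 x)).+1 + d)%N.
have hU t j : M%:R <= t < 2 * M%:R ->
    (l1norm (ray x (j.+1%:R * t) - ray x (j%:R * t))%R <= U)%N.
  move=> /andP[tM t2]; rewrite -(ler_nat R) (le_trans (l1norm_ray_sub _ _ _))//.
  have X0 : 0 <= 2 * M%:R * norm1 x by rewrite mulr_ge0 ?norm1_ge0.
  have /andP[_ h] := Num.Theory.truncn_itv X0.
  rewrite /U natrD lerD2r (le_trans _ (ltW h))// ler_wpM2r ?norm1_ge0//.
  have t0 : 0 <= t by exact: le_trans (ler0n _ _) tM.
  by rewrite -natr1 mulrDl mul1r addrC addKr ger0_norm// ltW.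
have [K0 hK0] := uniform_on_ball (mean_ball_approx lawQ nu2) U.
pose K := (K0 + U)%N.
pose xb1 := `|x ord0 b|; have xb1_gt0 : 0 < xb1 by rewrite normr_gt0.
have K1 : 0 <= ((2 * K).+1)%:R / xb1 by rewrite divr_ge0// ltW.
pose q := (Num.truncn (((2 * K).+1)%:R / xb1)).+1.
have hq : ((2 * K).+1)%:R < q%:R * xb1.
  by rewrite -ltr_pdivrMr//; have /andP[] := Num.Theory.truncn_itv K1.
pose B := U%:R ^+ 2 * mean nu (fun x => x ^+ 2).
have B0 : 0 <= B by rewrite mulr_ge0 ?sqr_ge0// mean_ge0// => z; exact: sqr_ge0.
have M0' : (0 : R) < M%:R by rewrite ltr0n.
exists K => V hV.
have key n : (M <= n)%N -> walk V 0 (ray x n%:R) !=set0 /\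
    fine (Q [set w | n%:R * (mu + e) < fpt V 0 (ray x n%:R) w]) <=
    (2 * q%:R * B / (e / 3) ^+ 2 * (2 * M%:R)) / n%:R.
  move=> Mn; pose k := (n %/ M)%N.
  have k0 : (0 < k)%N by rewrite divn_gt0.
  have k0' : (0 : R) < k%:R by rewrite ltr0n.
  have n0' : (0 : R) < n%:R by rewrite ltr0n (leq_trans M0).
  have kM : (k * M <= n)%N by exact: leq_trunc_div.
  have nk : (n < k.+1 * M)%N by rewrite ltn_ceil.
  have nMk : (n < 2 * M * k)%N.
    rewrite (leq_trans nk)// mulnAC leq_mul2r.
    by rewrite mul2n -addnn -addn1 leq_add2l k0 orbT.
  pose t : R := n%:R / k%:R.
  have kt : k%:R * t = n%:R by rewrite mulrC divfK ?gt_eqF.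
  have tM : M%:R <= t < 2 * M%:R.
    by rewrite /t ler_pdivlMr// ltr_pdivrMr// -!natrM ler_nat ltr_nat mulnC kM nMk.
  have /andP[tM1 _] := tM.
  have t1 : 1 <= t by rewrite (le_trans _ tM1)// ler1n.
  have t0 : 0 <= t by exact: le_trans ler01 t1.
  pose v j := ray x (j%:R * t).
  have v0 : v 0%N = 0 by rewrite /v mul0r ray0.
  have vk : v k = ray x n%:R by rewrite /v kt.
  have hv j : (l1norm (v j.+1 - v j)%R <= U)%N by exact: hU.
  have hw j : walk (l1ball (v j) K) (v j) (v j.+1) !=set0.
    have [p wp _] := walk_l1ball (v j) (v j.+1); exists p; apply: walk_sub wp.
    by apply: l1ball_sub; rewrite (leq_trans (hv j))// leq_addl.
  have hVj j : l1ball (v j) K `<=` V by apply: hV; rewrite mulr_ge0.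
  have [wV chain] := tube_chain k hw hVj v0; rewrite vk in wV chain.
  split=> //.
  pose Y j : weights -> R := fpt (l1ball (v j) K) (v j) (v j.+1).
  have mY j : mean Q (Y j) <= t * (mu + e / 3) + C.
    rewrite /Y (mean_ball_shift lawQ nu2).
    have [_ h] := hK0 _ K (hv j) (leq_addr _ _).
    apply: (le_trans h); rewrite /C addrA lerD2r.
    have := mean_time_ray_increment lawQ nu2 x (j%:R * t) t.
    have -> : j%:R * t + t = j.+1%:R * t by rewrite -natr1 mulrDl mul1r.
    move=> /le_trans; apply; rewrite lerD2r; exact: hM.
  have Y2 j : mean Q (fun w => Y j w ^+ 2) <= B.
    have [p wp sp] := walk_l1ball (v j) (v j.+1).
    have wp' : walk (l1ball (v j) K) (v j) (v j.+1) p.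
      by apply: walk_sub wp; apply: l1ball_sub; rewrite (leq_trans (hv j))// leq_addl.
    have [_ _ _ h] := mean_fpt_walk lawQ nu2 wp'.
    apply: (le_trans h); rewrite ler_wpM2r//; first by apply: mean_ge0 => z; exact: sqr_ge0.
    by rewrite lerXn2r ?nnegrE// ler_nat (leq_trans sp).
  have dep j : depends_on (inside (l1ball (v j) K)) (Y j) by exact: depends_on_fpt.
  have ind i j : (i + q <= j)%N ->
      mean Q (fun w => Y i w * Y j w) = mean Q (Y i) * mean Q (Y j).
    move=> ij; apply: (mean_mul_indep lawQ (F := inside (l1ball (v i) K)) _ _ _ _).2 => //;
      try exact: (has_mean_fpt lawQ nu2).
    apply: (depends_on_sub _ (dep j)); apply: inside_disjoint => u [/= uj ui].
    have h := l1norm_ray_lower x b (j%:R * t) (i%:R * t).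
    have : (l1norm (v j - v i)%R <= 2 * K)%N.
      have -> : v j - v i = (u - v i) - (u - v j) by rewrite opprB [RHS]addrC addrA subrK.
      by rewrite (leq_trans (l1normD _ _))// l1normN mul2n -addnn leq_add.
    rewrite -(ler_nat R) => h2.
    have h3 : q%:R <= `|j%:R * t - i%:R * t|.
      rewrite -mulrBl -natrB ?(leq_trans _ ij) ?leq_addr// ger0_norm ?mulr_ge0//.
      apply: le_trans (_ : (j - i)%:R <= _).
        by rewrite ler_nat leq_subRL ?(leq_trans _ ij) ?leq_addr.
      by rewrite ler_peMr.
    have h4 : q%:R * xb1 <= `|j%:R * t - i%:R * t| * xb1 by rewrite ler_pM2r.
    move: hq; rewrite -natr1; rewrite -/xb1 in h; lra.
  have := chebyshev_local B0 e3 k0 (fun j => has_mean_fpt lawQ nu2 _ _ _)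
    (fun j => has_mean_fpt2 lawQ nu2 _ _ _) Y2 ind.
  have sub : [set w | n%:R * (mu + e) < fpt V 0 (ray x n%:R) w] `<=`
     [set w | \sum_(j < k) mean Q (Y j) + k%:R * (e / 3) < \sum_(j < k) Y j w].
    move=> w /= h; apply: lt_le_trans (chain w); apply: le_lt_trans h.
    apply: le_trans (_ : \sum_(j < k) (t * (mu + e / 3) + C) + k%:R * (e / 3) <= _).
      by rewrite lerD2r; apply: ler_sum => j _; exact: mY.
    rewrite sumr_const card_ord -[X in X + _]mulr_natl -mulrDr -kt -mulrA ler_pM2l//.
    have : e / 3 * M%:R <= e / 3 * t by rewrite ler_pM2l.
    have : e / 3 * 1 <= e / 3 * t by rewrite ler_pM2l.
    by move: MC; nra.
  have le1 : fine (Q [set w | n%:R * (mu + e) < fpt V 0 (ray x n%:R) w]) <=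
     fine (Q [set w | \sum_(j < k) mean Q (Y j) + k%:R * (e / 3) < \sum_(j < k) Y j w]).
    apply: prob_le => //; apply: measurable_gt; first exact: measurable_fpt.
    by apply: measurable_sum => j; exact: measurable_fpt.
  move=> /(le_trans le1) /le_trans; apply.
  rewrite invfM [leLHS]mulrA -[leRHS]mulrA ler_wpM2l//.
    by rewrite divr_ge0 ?sqr_ge0// mulr_ge0// mulr_ge0.
  by rewrite ler_pdivlMr// mulrC ler_pdivrMr// -!natrM ler_nat ltnW.
split.
  by exists M => // n /= Mn; exact: (key n Mn).1.
set D := 2 * q%:R * B / (e / 3) ^+ 2 * (2 * M%:R) in key.
apply: (@squeeze_cvgr _ _ _ _ (fun=> 0) (fun n => D / n%:R)).
- near=> n; rewrite fine_ge0 ?measure_ge0//=.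
  by apply: (key n _).2; near: n; exact: nbhs_infty_ge.
- exact: cvg_cst.
- rewrite -[X in _ --> X](mulr0 D); apply: cvgM; first exact: cvg_cst.
  apply/gtr0_cvgV0; last exact: cvgr_idn.
  by near=> n; rewrite ltr0n; near: n; exact: nbhs_infty_gt.
Unshelve. all: by end_near.
Qed.

End tube.

(** * Cost of the two ends *)

Section subadditive_power.
Context {R : realType} (r : R).
Hypotheses (r0 : 0 < r) (r1 : r <= 1).

Lemma powR_mono (a b : R) : 0 <= a -> a <= b -> a `^ r <= b `^ r.
Proof.
move=> a0 ab; apply: ge0_ler_powR; rewrite ?nnegrE ?(ltW r0)//.
exact: le_trans ab.
Qed.

(** For [0 <= u <= 1] one has [u <= u^r]; apply it to [a / (a + b)] and
    [b / (a + b)]. *)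
Lemma powR_subadd (a b : R) : 0 <= a -> 0 <= b -> (a + b) `^ r <= a `^ r + b `^ r.
Proof.
move=> a0 b0; have [->|an0] := eqVneq a 0; first by rewrite add0r lerDr powR_ge0.
have a_gt0 : 0 < a by rewrite lt_neqAle eq_sym an0.
have s0 : 0 < a + b by rewrite ltr_pwDl.
suff h c : 0 <= c -> c <= a + b -> c / (a + b) * (a + b) `^ r <= c `^ r.
  apply: le_trans (lerD (h a a0 _) (h b b0 _)); rewrite ?lerDl ?lerDr//.
  by rewrite -!mulrDl divff ?mul1r// gt_eqF.
move=> c0 cs; have [->|cn0] := eqVneq c 0; first by rewrite !mul0r powR_ge0.
have c_gt0 : 0 < c by rewrite lt_neqAle eq_sym cn0.
have -> : c `^ r = (c / (a + b)) `^ r * (a + b) `^ r.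
  by rewrite -powRM ?divfK ?gt_eqF// ?divr_ge0// ltW.
rewrite ler_wpM2r ?powR_ge0//; apply: ger1_powR => //.
by rewrite divr_gt0//= ler_pdivrMr// mul1r.
Qed.

Lemma powR_sum_le (I : Type) (s : seq I) (f : I -> R) : (forall i, 0 <= f i) ->
  (\sum_(i <- s) f i) `^ r <= \sum_(i <- s) f i `^ r.
Proof.
move=> f0; elim: s => [|i s IH]; first by rewrite !big_nil powR0// gt_eqF.
rewrite !big_cons (le_trans (powR_subadd _ _))// ?sumr_ge0// lerD2l//.
Qed.

End subadditive_power.

Lemma uniq_flatten_map (I J : eqType) (hs : seq I) (s : I -> seq J) : uniq hs ->
  (forall h, uniq (s h)) -> (forall h h' e, e \in s h -> e \in s h' -> h = h') ->
  uniq (flatten [seq s h | h <- hs]).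
Proof.
move=> uhs us ds; elim: hs uhs => //= h hs IH /andP[hhs uhs].
rewrite cat_uniq us IH// andbT /=; apply/hasPn => e /flattenP[_ /mapP[h' h's ->] es'].
by apply/negP => es; move: hhs; rewrite (ds _ _ _ es es') h's.
Qed.

Section ends.
Context {R : realType} {d : nat}.
Local Notation weights := (@config R (edge d)).
Context (nu : probability R R) (Q : probability weights R).
Hypothesis lawQ : has_product_law nu Q.
Variables (r be : R).
Hypotheses (r0 : 0 < r) (r1 : r <= 1) (be0 : 0 < be).
Hypothesis nu_exp : has_mean nu (fun x => expR (be * `|x| `^ r)).

Let M := mean nu (fun x => expR (be * `|x| `^ r)).

(** The exponential Markov inequality for independent summands. *)
Lemma chernoff_sum (s : seq (edge d)) (c : R) : uniq s ->
  fine (Q [set w | c <= \sum_(e <- s) `|w e| `^ r]) <= expR (- be * c) * M ^+ size s.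
Proof.
move=> us.
have he (e : edge d) : has_mean Q (fun w : weights => expR (be * `|w e| `^ r)).
  exact: (has_mean_coord lawQ e nu_exp).
have [hp mp] := mean_prod_indep lawQ (F := fun e => [set e])
  (f := fun e w => expR (be * `|w e| `^ r)) us he
  (fun e w w' ww' => congr1 (fun z : R => expR (be * `|z| `^ r)) (ww' e erefl))
  (fun i j z _ _ zi zj => etrans (esym zi) zj).
have E w : \prod_(e <- s) expR (be * `|w e| `^ r) =
    expR (be * \sum_(e <- s) `|w e| `^ r).
  by rewrite mulr_sumr expR_sum.
have := markov_ineq hp (expR_ge0 (be * c)); rewrite mp.
under eq_bigr do rewrite (mean_coord lawQ _ nu_exp).
rewrite big_const_seq count_predT iter_mulr_1 -/M mulNr expRN => h.
rewrite mulrC ler_pdivlMr ?expR_gt0//; apply: le_trans h.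
rewrite ler_wpM2r ?expR_ge0//.
rewrite le_eqVlt; apply/orP; left; apply/eqP; congr (fine (Q _)).
by apply/seteqP; split=> w /=; rewrite E ler_expR ler_pM2l.
Qed.

Variables (a b : 'I_d).
Hypothesis ab : a != b.

(** On the event, along each of the [2d] routes, [u^r] is at most the sum of the [tau_e^r] over
    the route near [0] and its translate near [z]. The routes are disjoint, and
    the two families are separated because the first stays in [|v_b| <= 2] while
    [|z_b| > 4]; so the [2d] bounds add up to a sum over distinct edges. *)
Theorem two_ends (D : nat) (z : vertex d) (u : R) :
  (4 < `|z ord0 b|)%N -> 0 <= u -> forall y : vertex d, y = delta_mx 0 a *+ D ->
  fine (Q [set w | u < fpt setT 0 y w + fpt setT (y + z) z w]) <=
    expR (- be * ((2 * d)%:R * u `^ r)) * M ^+ (4 * d * (D + 8)).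
Proof.
move=> zb u0 y yE.
have M1 : 1 <= M.
  rewrite -(mean_cst nu 1); apply: mean_le => //; first exact: has_mean_cst.
  by move=> t; rewrite -expR0 ler_expR mulr_ge0 ?powR_ge0// ltW.
have [p [wp dp sp]] := edge_disjoint_walks D ab; rewrite -yE in wp.
have [hs [uhs shs]] : exists hs : seq ('I_d * bool), uniq hs /\ size hs = (2 * d)%N.
  exists (enum (('I_d * bool)%type : finType)); split; first exact: enum_uniq.
  by rewrite -cardE card_prod card_ord card_bool mulnC.
pose s h := undup (edges 0 (p h)).
pose S := flatten [seq s h | h <- hs].
have uS : uniq S.
  apply: uniq_flatten_map; [exact: uhs|by move=> h; exact: undup_uniq|].
  by move=> h h' e; rewrite !mem_undup; exact: dp.
pose S' := [seq eshift z e | e <- S].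
have slabS e v : e \in S -> v \in val e -> (`|v ord0 b| <= 2)%N.
  move=> /flattenP[_ /mapP[h _ ->]]; rewrite mem_undup => eh ve.
  have [_ _ h2] := wp h; apply: h2; exact: mem_edges_vertices eh ve.
have uSS : uniq (S ++ S').
  rewrite cat_uniq uS map_inj_uniq ?uS ?andbT; last exact: can_inj (eshiftK z).
  apply/hasPn => _ /mapP[e eS ->]; apply/negP => eS'.
  have [v ve] := edge_vertex (eshift z e).
  have := slabS _ _ eS' ve; rewrite mem_eshift in ve.
  have := slabS _ _ eS ve; rewrite !mxE.
  by move: (v ord0 b) (z ord0 b) zb => v1 z1; lia.
have sizeS : (size (S ++ S') <= 4 * d * (D + 8))%N.
  rewrite size_cat size_map addnn -muln2 size_flatten /shape -map_comp sumnE big_map.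
  rewrite (_ : 4 * d * (D + 8) = (2 * d * (D + 8)) * 2)%N; last by lia.
  rewrite leq_mul2r /=.
  apply: (@leq_trans (\sum_(h <- hs) (D + 8))%N).
    apply: leq_sum => h _ /=; rewrite (leq_trans (size_undup _))//.
    exact: leq_trans (size_edges _ _) (sp h).
  by rewrite big_const_seq count_predT iter_addn_0 shs mulnC.
have key w : u < fpt setT 0 y w + fpt setT (y + z) z w ->
    (2 * d)%:R * u `^ r <= \sum_(e <- S ++ S') `|w e| `^ r.
  move=> hu; rewrite big_cat /= /S' big_map /S !big_flatten !big_map -big_split /=.
  have -> : (2 * d)%:R * u `^ r = \sum_(h <- hs) u `^ r.
    by rewrite big_const_seq count_predT iter_addr_0 shs mulr_natl.
  apply: ler_sum => h _; have wh := walk_sub (@subsetT _ _) (wp h).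
  have h1 : fpt setT 0 y w <= \sum_(e <- s h) `|w e| by exact: fpt_le.
  have h2 : fpt setT (y + z) z w <= \sum_(e <- s h) `|w (eshift z e)|.
    rewrite fptC.
    have := @fpt_shift R d z setT 0 y w; rewrite add0r => ->.
    exact: (fpt_le (w \o eshift z) wh).
  apply: le_trans (lerD (powR_sum_le r0 r1 _ _) (powR_sum_le r0 r1 _ _)) => //.
  have A0 : 0 <= \sum_(e <- s h) `|w e| by exact: sumr_ge0.
  have A'0 : 0 <= \sum_(e <- s h) `|w (eshift z e)| by exact: sumr_ge0.
  have h3 := powR_subadd r1 A0 A'0; apply: le_trans h3.
  by apply: (powR_mono r0) => //; apply: (le_trans (ltW hu)); exact: lerD.
apply: (@le_trans _ _ (fine (Q [set w | (2 * d)%:R * u `^ r <= \sum_(e <- S ++ S') `|w e| `^ r]))).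
  apply: prob_le.
  - by apply: measurable_gt; apply: measurable_funD; exact: measurable_fpt.
  - apply: measurable_ge; apply: measurable_sum => e.
    apply: (measurableT_comp (measurable_powR _)).
    by apply: measurableT_comp => //; exact: measurable_coord.
  - by move=> w /= /key.
apply: (le_trans (chernoff_sum _ uSS)).
by rewrite ler_wpM2l ?expR_ge0// ler_weXn2l.
Qed.

End ends.

(** * Upper bound *)

Lemma natr_powR_large {R : realType} (r c : R) : 0 < r ->
  \forall n \near \oo, c <= n%:R `^ r.
Proof.
move=> r0; pose c' := Num.max c 0.
near=> n; apply: (@le_trans _ _ c'); first by rewrite /c' le_max lexx.
have c'0 : 0 <= c' by rewrite /c' le_max lexx orbT.
have -> : c' = (c' `^ r^-1) `^ r by rewrite -powRrM mulVf ?powRr1// gt_eqF.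
apply: (powR_mono r0); rewrite ?powR_ge0//; near: n; exact: nbhs_infty_ger.
Unshelve. all: by end_near.
Qed.

Lemma two_le_expR1 {R : realType} : 2 <= expR 1 :> R.
Proof. by have := expR_ge1Dx (1 : R); lra. Qed.

Lemma natr_le_expR {R : realType} (N : nat) : N%:R <= expR N%:R :> R.
Proof. by have := expR_ge1Dx (N%:R : R); lra. Qed.

Lemma tubes_exponent {R : realType} (th nr X : R) :
  1 <= nr -> (th + 1) * nr <= X -> th * nr + 1 <= X.
Proof. by lra. Qed.

Lemma half_exponent {R : realType} (c eta nr : R) :
  2 * c <= nr * eta -> c <= eta / 2 * nr.
Proof. by lra. Qed.

Lemma ends_exponent {R : realType} (N A B X nr th th1 : R) :
  (1 + A) * N <= X -> X = (th1 - th) / 2 * nr + (1 + A) ->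
  1 + A + B + 1 <= (th1 - th) / 2 * nr ->
  N + (- th1 * nr + (A * N + B)) <= - (th * nr) - 1.
Proof. by lra. Qed.

Section slabs.
Context {R : realType} {d : nat} (x : 'rV[R]_d) (a b : 'I_d).

(** A linear form that vanishes in the direction [x]: its level sets are the tubes,
    and translating along the axis [a] changes the level. *)
Definition transverse (v : vertex d) : R :=
  x ord0 b * (v ord0 a)%:~R - x ord0 a * (v ord0 b)%:~R.

Definition slab (k : R) : set (vertex d) := [set v | `|transverse v| <= k].

Lemma transverseB u v : transverse (u - v) = transverse u - transverse v.
Proof. by rewrite /transverse !mxE !rmorphB /=; ring. Qed.

Lemma tube_in_slab (K : nat) t :
  l1ball (ray x t) K `<=` slab (K.+1%:R * (`|x ord0 a| + `|x ord0 b|)).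
Proof.
move=> v; rewrite /l1ball /= => vK.
have near i : `|(v ord0 i)%:~R - t * x ord0 i| <= K.+1%:R.
  have h1 : `|(v ord0 i)%:~R - (ray x t ord0 i)%:~R| <= K%:R :> R.
    rewrite -rmorphB /= -absz_real ler_nat.
    by apply: leq_trans vK; have := l1norm_coord (v - ray x t) i; rewrite !mxE.
  have /andP[h2 h3] := ray_coord x t i; rewrite -natr1.
  move: h1; rewrite ler_norml => /andP[h4 h5].
  by rewrite ler_norml; apply/andP; split; lra.
rewrite /slab /=.
have -> : transverse v = x ord0 b * ((v ord0 a)%:~R - t * x ord0 a) -
   x ord0 a * ((v ord0 b)%:~R - t * x ord0 b) by rewrite /transverse; ring.
rewrite (le_trans (ler_normB _ _))// !normrM mulrDr addrC.
rewrite [_ * `|x ord0 a|]mulrC [_ * `|x ord0 b|]mulrC.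
by apply: lerD; rewrite ler_wpM2l.
Qed.

Lemma transverse_axis n : a != b ->
  transverse (delta_mx 0 a *+ n) = n%:R * x ord0 b.
Proof.
move=> ab; rewrite /transverse !mulmxnE !mxE !eqxx eq_sym (negbTE ab) /= mul0rn mulr0 subr0.
by rewrite mulrC; congr (_ * _); rewrite rmorphMn.
Qed.

Lemma slabs_disjoint (L : nat) k (i j : nat) (v : vertex d) : a != b ->
  2 * k < L%:R * `|x ord0 b| ->
  slab k (v - delta_mx 0 a *+ (i * L)) -> slab k (v - delta_mx 0 a *+ (j * L)) -> i = j.
Proof.
move=> ab kL; rewrite /slab /= !transverseB !transverse_axis//.
wlog ij : i j / (i <= j)%N.
  move=> h; have [ij|/ltnW ji] := leqP i j; first exact: h.
  by move=> hi hj; apply/esym; apply: h.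
move=> hi hj; apply/eqP; rewrite eqn_leq ij /= leqNgt; apply/negP => lij.
have : L%:R * `|x ord0 b| <= 2 * k; last by rewrite leNgt kL.
apply: (@le_trans _ _ `|(j * L)%:R * x ord0 b - (i * L)%:R * x ord0 b|).
  rewrite -mulrBl normrM ler_wpM2r// -natrB ?leq_mul2r ?ij ?orbT// -mulnBl normr_nat ler_nat.
  by rewrite leq_pmull// subn_gt0.
have -> : (j * L)%:R * x ord0 b - (i * L)%:R * x ord0 b =
   (transverse v - (i * L)%:R * x ord0 b) - (transverse v - (j * L)%:R * x ord0 b) by ring.
by rewrite (le_trans (ler_normB _ _))//; move: hi hj; lra.
Qed.

End slabs.

Section upper_bound.
Context {R : realType} {d : nat}.
Local Notation weights := (@config R (edge d)).
Context (nu : probability R R) (Q : probability weights R).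
Hypothesis lawQ : has_product_law nu Q.
Hypothesis nu2 : has_mean nu (fun x => x ^+ 2).
Variables (r al : R).
Hypotheses (r0 : 0 < r) (r1 : r <= 1) (al0 : 0 < al).
Hypothesis nu_exp : forall be, 0 < be -> be < al ->
  has_mean nu (fun x => expR (be * `|x| `^ r)).
Variables (x : 'rV[R]_d) (a b : 'I_d).
Hypotheses (ab : a != b) (xb : x ord0 b != 0).
Variable mu : R.
Hypothesis cvg_mu : t^-1 * mean_time Q (ray x t) @[t --> +oo] --> mu.

Let y (D : nat) : vertex d := delta_mx 0 a *+ D.

(** The tubes are translates of [V] with pairwise disjoint edge sets. *)
Lemma all_tubes_slow (V : set (vertex d)) (L N : nat) (z : vertex d) (c : R) :
  (forall i j v, V (v - y (i * L)) -> V (v - y (j * L)) -> i = j) ->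
  let slow i := [set w : weights |
    c < fpt [set v | V (v - y (i * L))] (y (i * L)) (z + y (i * L)) w] in
  measurable [set w | forall i, i \in iota 0 N -> slow i w] /\
  fine (Q [set w | forall i, i \in iota 0 N -> slow i w]) =
    fine (Q [set w | c < fpt V 0 z w]) ^+ N.
Proof.
move=> Vdisj slow.
have mslow i : measurable (slow i) by apply: measurable_gt; exact: measurable_fpt.
have dslow i : depends_on (inside [set v | V (v - y (i * L))]) (slow i).
  by move=> w w' ww'; rewrite /slow /= (depends_on_fpt _ _ ww').
have disj i j e : i \in iota 0 N -> j \in iota 0 N ->
    inside [set v | V (v - y (i * L))] e -> inside [set v | V (v - y (j * L))] e -> i = j.
  by move=> _ _ ei ej; have [v ve] := edge_vertex e; apply: (Vdisj i j v); [exact: ei|exact: ej].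
have [mC ->] := prob_bigcap_indep lawQ (iota_uniq 0 N) mslow dslow disj.
split=> //.
rewrite (eq_bigr (fun=> fine (Q [set w | c < fpt V 0 z w]))).
  by rewrite big_const_seq count_predT iter_mulr_1 size_iota.
move=> i _.
have m0 : measurable [set w : weights | c < fpt V 0 z w].
  by apply: measurable_gt; exact: measurable_fpt.
rewrite -(prob_reindex lawQ (eshiftK (y (i * L))) (eshiftNK (y (i * L))) m0).
congr (fine (Q _)); apply/seteqP; split=> w; rewrite /slow /=;
  by have := fpt_shift (y (i * L)) V 0 z w; rewrite add0r => ->.
Qed.

(** For [s < 1] close to one, take [e = xi (1 - s)] and [be = al s]; as
    [s <= s^r], the ends cost at least [2d al xi^r s^2], which exceeds [th]. The
    factor [M^O(N)] and the union over the [N] tubes are absorbed in the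
    difference [eta] by the choice of [de], where [N] is about [de n^r]. *)
Theorem upper_bound (xi th : R) : 0 < xi -> 0 <= th -> th < (2 * d)%:R * al * xi `^ r ->
  \forall n \near \oo,
    fine (Q [set w | n%:R * (mu + xi) < fpt setT 0 (ray x n%:R) w]) <=
    expR (- th * n%:R `^ r).
Proof.
move=> xi0 th0; set S := _ * _ * _ => thS.
have S0 : 0 < S by exact: le_lt_trans thS.
(* [S * s ^+ 2 > th], since [s ^+ 2 >= (1 + th / S) / 2] and [th < S] *)
pose s := 1 - (1 - th / S) / 4.
have rho1 : th / S < 1 by rewrite ltr_pdivrMr// mul1r.
have rho0 : 0 <= th / S by rewrite divr_ge0// ltW.
have s1 : s < 1 by rewrite /s; lra.
have s0 : 0 < s by rewrite /s; lra.
have s2 : th < S * s ^+ 2.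
  by rewrite mulrC -ltr_pdivrMr// /s; nra.
pose be := al * s; pose e := xi * (1 - s).
have be0 : 0 < be by exact: mulr_gt0.
have beal : be < al by rewrite /be gtr_pMr.
have e0 : 0 < e by rewrite mulr_gt0// subr_gt0.
pose th1 := be * ((2 * d)%:R * (xi * s) `^ r).
have th1_gt : th < th1.
  apply: (lt_le_trans s2); rewrite /th1 powRM ?(ltW xi0) ?(ltW s0)// /S /be.
  have ss : s <= s `^ r by apply: ger1_powR => //; rewrite s0 ltW.
  have -> : (2 * d)%:R * al * xi `^ r * s ^+ 2 = ((2 * d)%:R * al * xi `^ r * s) * s by ring.
  have -> : al * s * ((2 * d)%:R * (xi `^ r * s `^ r)) =
      ((2 * d)%:R * al * xi `^ r * s) * s `^ r by ring.
  by rewrite ler_wpM2l// mulr_ge0// ltW.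
pose eta := th1 - th; have eta0 : 0 < eta by rewrite subr_gt0.
have hE := nu_exp be0 beal; set M := mean nu (fun x => expR (be * `|x| `^ r)).
have M1 : 1 <= M.
  rewrite -(mean_cst nu 1); apply: mean_le => //; first exact: has_mean_cst.
  by move=> t; rewrite -[leLHS]expR0 ler_expR mulr_ge0 ?powR_ge0// ltW.
pose lM := ln M; have lM0 : 0 <= lM by exact: ln_ge0.
have ME : M = expR lM by rewrite lnK// posrE (lt_le_trans _ M1).
have [K hK] := tube_law_of_large_numbers lawQ nu2 xb cvg_mu e0.
pose k := K.+1%:R * (`|x ord0 a| + `|x ord0 b|).
have xb_gt0 : 0 < `|x ord0 b| by rewrite normr_gt0.
have k0 : 0 <= k by rewrite mulr_ge0// addr_ge0.
pose V := slab x a b k.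
have [] := hK V (fun t _ => @tube_in_slab R d x a b K t).
set p := fun n : nat => fine _ => walkV cvgp.
pose L := (Num.truncn (2 * k / `|x ord0 b|)).+1.
have hL : 2 * k < L%:R * `|x ord0 b|.
  have h : 0 <= 2 * k / `|x ord0 b| by rewrite divr_ge0// mulr_ge0.
  by rewrite -ltr_pdivrMr//; have /andP[] := Num.Theory.truncn_itv h.
pose c1 := 1 + lM * (4 * d * L)%:R.
have c1_gt0 : 0 < c1 by rewrite ltr_pwDl// mulr_ge0.
pose c0 := c1 + lM * (4 * d * 8)%:R + 1.
(* [c1 * (de * n^r)] is then half of the available gain [eta * n^r] *)
pose de := eta / (2 * c1); have de0 : 0 < de by rewrite divr_gt0// mulr_gt0.
have hp : \forall n \near \oo, p n <= expR (- ((th + 1) / de)).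
  have [n' _ hn] := (@cvgrPdist_lt _ _ _ _ _ _ _).1 cvgp _ (expR_gt0 (- ((th + 1) / de))).
  exists n' => // n /hn /=; rewrite sub0r normrN => /ltW; apply: le_trans.
  exact: ler_norm.
near=> n.
have n0 : (0 : R) < n%:R by rewrite ltr0n; near: n; exact: nbhs_infty_gt.
have hn1 : 1 <= n%:R `^ r by near: n; exact: natr_powR_large.
have hn2 : 2 * c0 / eta <= n%:R `^ r by near: n; exact: natr_powR_large.
have walkVn : walk V 0 (ray x n%:R) !=set0 by near: n; exact: walkV.
have pn : p n <= expR (- ((th + 1) / de)).
  by near: n; exact: hp.
have zb : (4 < `|ray x n%:R ord0 b|)%N.
  have h5 : 5 / `|x ord0 b| < n%:R by near: n; exact: nbhs_infty_gtr.
  rewrite ltr_pdivrMr// in h5; rewrite -(ltr_nat R) absz_real.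
  have /andP[h6 h7] := ray_coord x n%:R b.
  have := ler_normD ((ray x n%:R ord0 b)%:~R : R) (n%:R * x ord0 b - (ray x n%:R ord0 b)%:~R).
  rewrite addrC subrK normrM ger0_norm// [X in _ + X]ger0_norm; lra.
set z := ray x n%:R in walkVn zb *.
pose nr := n%:R `^ r.
pose N := (Num.truncn (de * nr)).+1.
have nr0 : 0 <= nr by exact: powR_ge0.
have /andP[N1 N2] := Num.Theory.truncn_itv (mulr_ge0 (ltW de0) nr0).
have N1' : N%:R <= de * nr + 1 by rewrite /N -natr1 lerD2r.
have Vdisj i j v : V (v - y (i * L)) -> V (v - y (j * L)) -> i = j.
  exact: slabs_disjoint.
have [] := all_tubes_slow N z (n%:R * (mu + e)) Vdisj.
set slow := [set w | forall i, _] => mslow pslow.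
pose ends i := [set w : weights | n%:R * (xi * s) <
  fpt setT 0 (y (i * L)) w + fpt setT (y (i * L) + z) z w].
have mends i : measurable (ends i).
  by apply: measurable_gt; apply: measurable_funD; exact: measurable_fpt.
have mendsU : measurable (\bigcup_(i < N) ends i) by exact: bigcup_measurable.
have cover : [set w | n%:R * (mu + xi) < fpt setT 0 z w] `<=` slow `|` \bigcup_(i < N) ends i.
  move=> w /= hw; apply: contrapT => /not_orP[hs he].
  apply: hs => i; rewrite mem_iota add0n => /andP[_ iN] /=.
  have he' : fpt setT 0 (y (i * L)) w + fpt setT (y (i * L) + z) z w <= n%:R * (xi * s).
    by rewrite leNgt; apply/negP => hi; apply: he; exists i.
  have [q wq] := walkVn.
  have wq' := walk_shift (y (i * L)) wq; rewrite add0r in wq'.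
  have h1 : fpt setT (y (i * L)) (z + y (i * L)) w <=
     fpt [set v | V (v - y (i * L))] (y (i * L)) (z + y (i * L)) w.
    by apply: fpt_mono; [exact: subsetT|exists [seq v + y (i * L) | v <- q]].
  apply: lt_le_trans h1.
  have h2 := fpt_triangle w (walkT 0 (y (i * L))) (walkT (y (i * L)) z).
  have h3 := fpt_triangle w (walkT (y (i * L)) (z + y (i * L))) (walkT (z + y (i * L)) z).
  rewrite [z + _]addrC in h3 *.
  have nE : n%:R * (mu + xi) = n%:R * (mu + e) + n%:R * (xi * s) by rewrite /e; ring.
  rewrite -(ltrD2r (n%:R * (xi * s))) -nE (lt_le_trans hw)// (le_trans h2)//.
  by apply: (le_trans (lerD (lexx _) h3)); rewrite addrCA lerD2l.
have mT : measurable [set w : weights | n%:R * (mu + xi) < fpt setT 0 z w].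
  by apply: measurable_gt; exact: measurable_fpt.
have pU : fine (Q [set w | n%:R * (mu + xi) < fpt setT 0 z w]) <=
    fine (Q slow) + fine (Q (\bigcup_(i < N) ends i)).
  by apply: prob_leU; [exact: mT|exact: mslow|exact: mendsU|exact: cover].
apply: (le_trans pU).
have thn : - th * n%:R `^ r = - (th * nr) by rewrite mulNr.
have half : expR (- (th * nr) - 1) * 2 <= expR (- (th * nr)).
  rewrite expRD -mulrA ler_piMr ?expR_ge0// expRN mulrC ler_pdivrMr ?expR_gt0// mul1r.
  exact: two_le_expR1.
rewrite thn; apply: le_trans half; rewrite mulr_natr mulr2n; apply: lerD.
  rewrite pslow -/(p n).
  have p0 : 0 <= p n by rewrite fine_ge0.
  apply: (@le_trans _ _ (expR (- ((th + 1) / de)) ^+ N)).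
    by rewrite lerXn2r ?nnegrE ?expR_ge0.
  rewrite -expRM_natr ler_expR mulNr lerNl opprD !opprK.
  have : (th + 1) / de * (de * nr) <= (th + 1) / de * N%:R.
    by rewrite ler_wpM2l ?(ltW N2)// divr_ge0 ?(ltW de0)// addr_ge0.
  have -> : (th + 1) / de * (de * nr) = (th + 1) * nr by field; rewrite gt_eqF.
  exact: tubes_exponent hn1.
have ends_le i : (i < N)%N -> fine (Q (ends i)) <= expR (- th1 * nr) * M ^+ (4 * d * (N * L + 8)).
  move=> iN.
  have u0 : 0 <= n%:R * (xi * s) by rewrite !mulr_ge0// ltW.
  apply: (le_trans (two_ends lawQ r0 r1 be0 hE ab zb u0 (erefl _))).
  apply: ler_pM; rewrite ?expR_ge0 ?exprn_ge0 ?(le_trans ler01)//.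
    rewrite ler_expR powRM ?mulr_ge0 ?(ltW xi0) ?(ltW s0)//.
    by rewrite le_eqVlt; apply/orP; left; apply/eqP; rewrite /th1 /nr; ring.
  rewrite ler_weXn2l// leq_mul2l leq_add2r leq_mul2r ltnW ?orbT//.
have sumends : fine (Q (\bigcup_(i < N) ends i)) <=
    N%:R * (expR (- th1 * nr) * M ^+ (4 * d * (N * L + 8))).
  rewrite -lee_fin -prob_fin// bigcup_mkord.
  apply: (le_trans (Boole_inequality _ _)) => //.
  apply: (@le_trans _ _ (\sum_(i < N) (expR (- th1 * nr) * M ^+ (4 * d * (N * L + 8)))%:E)%E).
    apply: lee_sum => i _; have := ends_le i (ltn_ord i).
    by rewrite -lee_fin -(prob_fin Q (mends i)).
  by rewrite sumEFin sumr_const card_ord mulr_natl.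
apply: (le_trans sumends).
have NE : N%:R <= expR N%:R :> R by exact: natr_le_expR.
apply: (@le_trans _ _ (expR N%:R * (expR (- th1 * nr) * M ^+ (4 * d * (N * L + 8))))).
  by rewrite ler_wpM2r// mulr_ge0 ?expR_ge0// exprn_ge0// (le_trans ler01).
rewrite ME -expRM_natr -!expRD ler_expR.
have -> : lM * (4 * d * (N * L + 8))%:R = lM * (4 * d * L)%:R * N%:R + lM * (4 * d * 8)%:R.
  by rewrite !natrM natrD natrM; ring.
have h1 : c1 * N%:R <= c1 * (de * nr + 1) by rewrite ler_wpM2l// ltW.
have h2 : c1 * (de * nr + 1) = eta / 2 * nr + c1.
  by rewrite /de; field; rewrite gt_eqF.
have h3 : c0 <= eta / 2 * nr.
  by apply: half_exponent; move: hn2; rewrite ler_pdivrMr.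
rewrite /c1 in h1 h2; rewrite /c0 /c1 in h3; rewrite /eta in h2 h3.
exact: ends_exponent h1 h2 h3.
Unshelve. all: by end_near.
Qed.

End upper_bound.

(** * Logarithmic asymptotics *)

(** The lower bounds make [p n] eventually positive, so that the extended logarithm
    is finite. *)
Lemma log_rate_cvg {R : realType} (p : nat -> R) (r S : R) : 0 < r -> 0 < S ->
  (forall th, 0 <= th -> th < S -> \forall n \near \oo, p n <= expR (- th * n%:R `^ r)) ->
  (forall th, S < th -> \forall n \near \oo, expR (- th * n%:R `^ r) <= p n) ->
  ((n%:R `^ r)^-1%:E * lne (p n)%:E)%E @[n --> \oo] --> (- S)%:E.
Proof.
move=> r0 S0 up low.
have hE n : 0 < p n -> ((n%:R `^ r)^-1%:E * lne (p n)%:E)%E = ((n%:R `^ r)^-1 * ln (p n))%:E.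
  by move=> pn; rewrite lne_EFin// EFinM.
have pos : \forall n \near \oo, 0 < p n.
  have S1 : S < S + 1 by rewrite ltrDl.
  by apply: filterS (low _ S1) => n; apply: lt_le_trans; exact: expR_gt0.
apply/fine_cvgP; split; first by apply: filterS pos => n pn; rewrite hE.
apply/cvgrPdist_lt => e e0.
have thS : Num.max 0 (S - e / 2) < S by rewrite gt_max S0 /= gtrBl divr_gt0.
have th0 : 0 <= Num.max 0 (S - e / 2) by rewrite le_max lexx.
have th'S : S < S + e / 2 by rewrite ltrDl divr_gt0.
near=> n.
have pn : 0 < p n by near: n.
have hu : p n <= expR (- Num.max 0 (S - e / 2) * n%:R `^ r) by near: n; exact: up.
have hl : expR (- (S + e / 2) * n%:R `^ r) <= p n by near: n; exact: low.
have nr : 0 < n%:R `^ r by rewrite powR_gt0// ltr0n; near: n; exact: nbhs_infty_gt.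
rewrite /= hE//= -opprD normrN; set v := _^-1 * _.
have lv : ln (p n) = v * n%:R `^ r by rewrite /v mulrC mulrA divff ?mul1r// gt_eqF.
have h1 : v <= - Num.max 0 (S - e / 2).
  by rewrite -(ler_pM2r nr) -lv -(expRK (_ * _)) ler_ln ?posrE ?expR_gt0.
have h2 : - (S + e / 2) <= v.
  by rewrite -(ler_pM2r nr) -lv -(expRK (- _ * _)) ler_ln ?posrE ?expR_gt0.
have h3 : S - e / 2 <= Num.max 0 (S - e / 2) by rewrite le_max lexx orbT.
by rewrite ltr_norml; apply/andP; split; lra.
Unshelve. all: by end_near.
Qed.

Section transfer.
Context {R : realType} {d : nat} {disp : measure_display}
  {T : measurableType disp} (P : probability T R) (tau : edge d -> {RV P >-> R}).
Local Notation weights := (@config R (edge d)).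

Definition weight_field (t : T) : weights := fun e => tau e t.

Lemma measurable_weight_field : measurable_fun setT weight_field.
Proof. by apply: measurable_config => e; exact: measurable_funP. Qed.

Definition field_rv : {RV P >-> weights} :=
  HB.pack weight_field (isMeasurableFun.Build _ _ _ _ _ measurable_weight_field).

Definition field_law : probability weights R := distribution P field_rv.

Lemma field_law_product (e0 : edge d) : iid tau ->
  has_product_law (distribution P (tau e0)) field_law.
Proof.
move=> [ind idd] J A mA.
transitivity (P (\bigcap_(i in [set` J]) tau i @^-1` A i)); first by [].
rewrite ind//; apply: eq_bigr => e _; exact: idd.
Qed.

Hypothesis tau_ge0 : forall e t, 0 <= tau e t.

Lemma passage_prob (c : R) (z : 'rV[R]_d) :
  P [set t | c < passage_time tau 0 z t] =
  (fine (field_law [set w | c < fpt setT 0 (floor_vertex z) w]))%:E.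
Proof.
rewrite -prob_fin; last by apply: measurable_gt; exact: measurable_fpt.
congr (P _); apply/seteqP.
by split=> t /=; rewrite passage_timeE// floor_vertex0.
Qed.

Lemma passage_mean (z : 'rV[R]_d) :
  fine 'E_P[passage_time tau 0 z] = mean_time field_law (floor_vertex z).
Proof.
rewrite /mean_time /mean unlock; congr fine.
rewrite (@ge0_integral_distribution _ _ _ _ _ P field_rv
  (fun w => (fpt setT 0 (floor_vertex z) w)%:E)).
- apply: eq_integral => t _ /=.
  by rewrite passage_timeE// floor_vertex0.
- by apply/measurable_EFinP; exact: measurable_fpt.
- by move=> w; rewrite lee_fin fpt_ge0.
Qed.

End transfer.

Theorem theorem1p1 (R : realType) (d : nat) (hd : (2 <= d)%N)
    (disp : measure_display) (T : measurableType disp) (P : probability T R)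
    (tau : edge d -> {RV P >-> R})
    (tau_iid : iid tau)
    (tau_ge0 : forall (e : edge d) (w : T), 0 <= tau e w)
    (c1 c2 alpha r : R)
    (c1_gt0 : 0 < c1) (c2_gt0 : 0 < c2) (alpha_gt0 : 0 < alpha)
    (r_gt0 : 0 < r) (r_le1 : r <= 1)
    (tau_zero : forall e : edge d,
      (P [set w | tau e w = 0%R] < (critical_probability R d)%:E)%E)
    (tau_tail : forall e : edge d, \forall t \near +oo,
      ((c1 * expR (- alpha * t `^ r))%:E <= P [set w | t < tau e w]%R)%E /\
      (P [set w | t < tau e w]%R <= (c2 * expR (- alpha * t `^ r))%:E)%E)
    (xi : R) (xi_gt0 : 0 < xi) (x : 'rV[R]_d) (x_neq0 : x <> 0) :
  ((n%:R `^ r)^-1%:E *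
     lne (P [set w | (n%:R * (time_constant tau x + xi) <
                      passage_time tau 0 (n%:R *: x) w)%R]))%E
    @[n --> \oo] --> (- (2 * d%:R * alpha * xi `^ r))%:E.
Proof.
have [b xb] : exists b : 'I_d, x ord0 b != 0.
  apply/existsP; rewrite -negb_forall; apply/negP => /forallP h; apply: x_neq0.
  by apply/rowP => i; rewrite mxE (eqP (h i)).
have [a ab] : exists a : 'I_d, a != b.
  apply/existsP; rewrite -negb_forall; apply/negP => /forallP h.
  have := hd; rewrite -[d in (_ <= d)%N]card_ord -(cardsT 'I_d).
  rewrite (_ : [set: 'I_d]%SET = [set b]%SET) ?cards1//.
  by apply/setP => i; rewrite !inE (h i).
have e0_edge : is_edge [fset 0; delta_mx 0 a : vertex d]%fset.
  by apply/asboolP; exists 0, (delta_mx 0 a); rewrite adjE sub0r l1normN l1norm_delta.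
pose e0 : edge d := Sub _ e0_edge.
pose Q := field_law tau.
pose nu : probability R R := distribution P (tau e0).
have lawQ : has_product_law nu Q by exact: field_law_product.
have nuE t : nu `]t, +oo[%classic = P [set w | t < tau e0 w].
  by congr (P _); apply/seteqP; split=> w; rewrite /= in_itv /= andbT.
have nu0 : nu `]-oo, 0[%classic = 0%E.
  rewrite -(measure0 P); congr (P _); apply/seteqP; split=> w //=.
  by rewrite in_itv /= ltNge tau_ge0.
have [t0 [_ tail]] := tau_tail e0.
have nu_exp be : 0 < be -> be < alpha -> has_mean nu (fun x => expR (be * `|x| `^ r)).
  move=> be0 beal; apply: (weibull_exp_moment r_gt0 be0 beal nu0 (c := c2) (t0 := t0)).
  move=> t /tail[_]; rewrite -nuE; rewrite -lee_fin -prob_fin//.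
have nu2 : has_mean nu (fun x => x ^+ 2).
  have a2 : 0 < alpha / 2 by rewrite divr_gt0.
  by apply: (second_moment r_gt0 a2); apply: nu_exp => //; lra.
have [mu [cvg_mu mu_le]] := time_constant_exists lawQ nu2 x.
have -> : time_constant tau x = mu.
  rewrite /time_constant; apply: cvg_lim => //.
  by under eq_fun do rewrite passage_mean//.
under eq_fun do rewrite passage_prob//.
set S := 2 * d%:R * alpha * xi `^ r.
have d0 : (0 : R) < d%:R by rewrite ltr0n (leq_trans _ hd).
have S0 : 0 < S by rewrite !mulr_gt0// powR_gt0.
apply: (@log_rate_cvg R (fun n =>
  fine (Q [set w | n%:R * (mu + xi) < fpt setT 0 (ray x n%:R) w]))) => //.
  move=> th th0 thS.
  by apply: (upper_bound lawQ nu2 r_gt0 r_le1 alpha_gt0 nu_exp ab xb cvg_mu) => //; rewrite natrM.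
(* [S * (1 + u) = (th + S) / 2 < th], while [(1 + u)^r <= 1 + u] *)
move=> th Sth; pose u := (th - S) / (2 * S); pose e := xi * u / 2.
have u0 : 0 < u by rewrite divr_gt0 ?subr_gt0// mulr_gt0.
have e0' : 0 < e by rewrite divr_gt0// mulr_gt0.
have [c c0 hc] := lower_bound lawQ nu2 xb mu_le xi_gt0 e0'.
pose th2 := 2 * d%:R * alpha * (xi + 2 * e) `^ r.
have th2S : th2 <= (th + S) / 2.
  rewrite /th2; have -> : xi + 2 * e = xi * (1 + u) by rewrite /e; field.
  have -> : (th + S) / 2 = S * (1 + u) by rewrite /u; field; rewrite gt_eqF.
  rewrite powRM ?(ltW xi_gt0) ?addr_ge0 ?(ltW u0)// mulrA ler_wpM2l ?(ltW S0)//.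
  by apply: ler1_powR => //; rewrite lerDl ltW.
pose kappa := c * c1 ^+ (2 * d).
have kappa0 : 0 < kappa by rewrite mulr_gt0// exprn_gt0.
have gap : 0 < (th - S) / 2 by rewrite divr_gt0 ?subr_gt0.
near=> n.
have n0 : (0 : R) < n%:R by rewrite ltr0n; near: n; exact: nbhs_infty_gt.
have xe0 : 0 < xi + 2 * e by rewrite addr_gt0// mulr_gt0.
have hcn : c * fine (nu `]n%:R * (xi + 2 * e), +oo[%classic) ^+ (2 * d) <=
    fine (Q [set w | n%:R * (mu + xi) < fpt setT 0 (ray x n%:R) w]) by near: n; exact: hc.
apply: le_trans hcn.
have tn : t0 < n%:R * (xi + 2 * e).
  by rewrite -ltr_pdivrMr//; near: n; exact: nbhs_infty_gtr.
have [hl _] := tail _ tn; rewrite -nuE (prob_fin nu) ?lee_fin// in hl.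
have nr : - ln kappa / ((th - S) / 2) <= n%:R `^ r by near: n; exact: natr_powR_large.
rewrite ler_pdivrMr// in nr.
apply: (@le_trans _ _ (kappa * expR (- th2 * n%:R `^ r))).
  rewrite -{1}(lnK (kappa0 : kappa \is Num.pos)) -expRD ler_expR.
  have : th2 * n%:R `^ r <= (th + S) / 2 * n%:R `^ r by rewrite ler_wpM2r ?powR_ge0.
  by lra.
rewrite /kappa -mulrA ler_wpM2l ?(ltW c0)//.
have -> : c1 ^+ (2 * d) * expR (- th2 * n%:R `^ r) =
    (c1 * expR (- alpha * (n%:R * (xi + 2 * e)) `^ r)) ^+ (2 * d).
  rewrite exprMn -expRM_natr; congr (_ * expR _).
  by rewrite /th2 powRM ?(ltW n0) ?(ltW xe0)// natrM; ring.
by rewrite lerXn2r ?nnegrE// ?mulr_ge0 ?expR_ge0 ?(ltW c1_gt0)// fine_ge0.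
Unshelve. all: by end_near.
Qed.
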